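(* Let $(w_n)_{n\ge0}$ be a decreasing sequence of positive real numbers with $w_n\downarrow0$. Then there exists a holomorphic self-map $b:\mathbb{D}\to\mathbb{D}$ such that for any $f\in\mathcal{H}(b)$, $$|\widehat f(n)|\le w_n,\quad n=0,1,2,\dots\implies f\equiv0.$$
   Context: $\mathbb{D}$ is the open unit disc. For a holomorphic function $f$ on $\mathbb{D}$, $(\widehat f(n))_{n\ge0}$ denotes its Taylor coefficients at $0$. For a holomorphic $b:\mathbb{D}\to\mathbb{D}$, the de Branges-Rovnyak space $\mathcal{H}(b)$ is the reproducing kernel Hilbert space of holomorphic functions on $\mathbb{D}$ with reproducing kernel $\frac{1-\overline{b(\lambda)}b(z)}{1-\overline{\lambda}z}$, $z,\lambda\in\mathbb{D}$. *)

(* Defs.v *)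
From HB Require Import structures.
From mathcomp Require Import all_boot all_order all_algebra.
From mathcomp Require Import sesquilinear complex.
From mathcomp Require Import all_classical all_reals all_analysis.

Set Implicit Arguments.
Unset Strict Implicit.
Unset Printing Implicit Defensive.

Import Order.TTheory GRing.Theory Num.Theory Num.Def.
Import numFieldNormedType.Exports.

Local Open Scope classical_set_scope.
Local Open Scope ring_scope.
Local Open Scope complex_scope.

(* Functions on the disc are represented by total functions R[i] -> R[i] of
   which only the restriction to the disc is ever used. *)
Definition unit_disc (R : realType) : set R[i] := [set z | `|z| < 1].

Definition holomorphic_on_disc (R : realType) (f : R[i] -> R[i]) : Prop :=
  forall z, unit_disc z -> derivable (f : R[i]^o -> R[i]^o) z 1.

(* The n-th derivative at 0 only depends on f near 0, hence only on f on the
   disc. *)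
Definition taylor_coef (R : realType) (f : R[i] -> R[i]) (n : nat) : R[i] :=
  derive1n n (f : R[i] -> R[i]^o) 0 / n`!%:R.

(* The elements of a reproducing kernel Hilbert space H of holomorphic
   functions are given as vectors h : H together with the function ev h they
   stand for; rkhs_inj says that a vector is determined by its function on the
   disc, so that H is a space of functions on the disc. The form ip is linear
   in its first argument. *)
Record is_RKHS (R : realType) (k : R[i] -> R[i] -> R[i])
    (H : completeNormedModType R[i]) (ip : {dot H for conjC})
    (ev : H -> R[i] -> R[i]) : Prop := IsRKHS {
  rkhs_norm : forall h : H, `|h| ^+ 2 = ip h h;
  rkhs_lin : forall (a : R[i]) (g h : H) (z : R[i]), unit_disc z ->
    ev (a *: g + h) z = a * ev g z + ev h z;
  rkhs_inj : forall h : H, (forall z, unit_disc z -> ev h z = 0) -> h = 0;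
  rkhs_holomorphic : forall h : H, holomorphic_on_disc (ev h);
  rkhs_reproducing : forall l : R[i], unit_disc l ->
    exists2 kl : H, (forall z, unit_disc z -> ev kl z = k z l)
                  & (forall h : H, ev h l = ip h kl)
}.

Definition dBR_kernel (R : realType) (b : R[i] -> R[i]) (z l : R[i]) : R[i] :=
  (1 - (b l)^* * b z) / (1 - l^* * z).

(* For b mapping the disc to itself the kernel is positive definite, so by the
   Moore-Aronszajn theorem the space H below exists and is unique up to an
   isometry compatible with ev; membership thus does not depend on which
   realization H is used. *)
Definition in_dBR (R : realType) (b f : R[i] -> R[i]) : Prop :=
  exists (H : completeNormedModType R[i]) (ip : {dot H for conjC})
         (ev : H -> R[i] -> R[i]),
    is_RKHS (dBR_kernel b) ip ev /\
    exists h : H, forall z, unit_disc z -> f z = ev h z.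

(* Main.v *)
Require Import Defs.
From HB Require Import structures.
From mathcomp Require Import all_boot all_order all_algebra.
From mathcomp Require Import sesquilinear complex.
From mathcomp Require Import all_classical all_reals all_analysis.
From mathcomp Require Import cyclic separable cyclotomic ring lra zify.

(** The self-map is an inner function without zeros, [b = exp(-h)], where [h] is
the Herglotz transform of a singular probability measure on the circle, built
as a generalised Riesz product whose gaps are chosen after the weights [w].

Inner functions give linear relations. Write an element of H(b) as
[f = sum alpha_n z^n]. A finite combination of values [sum c_i f(l_i)] is at most
[|f|] times the norm of [sum conj(c_i) k_(l_i)], and the square of that norm is
[sum_n |x_n|^2 - sum_n |y_n|^2], where [x_n] and [y_n] are the moments
[sum c_i l_i^n] and [sum c_i b(l_i) l_i^n]. Points at the roots of unity, on the
circle of radius 1/2, approximate in this way every pairing of [f] with a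
polynomial; in particular [f] has a power series, and for the truncated shifts of
[b] the bound reads
  [|sum_(n < N) conj(b_n) alpha_(n+m)|^2 <= |f|^2 (S - S^2)], [S = sum_(n < N) |b_n|^2]
([shifted_pairing]). For inner [b] the sums [S] tend to 1, so that
[sum_n b_n alpha_(n+m) = 0] for every [m].

Cyclicity turns the relations into [alpha = 0]. If there are polynomials [p] such
that [b p] has constant coefficient 1 and [sum_(n >= 1) |(b p)_n| w_n] is as small
as desired, then combining the relations gives [|alpha_m| <= eps] as soon as
[|alpha_n| <= w_n] ([vanishing_of_cyclic]).

It remains to find such a [b]. The polynomials [h_0 = 1, h_1, h_2, ...] have real
coefficients, [h_J(0) = 1] and nonnegative real part [u_J] on the circle;
[u_(J+1)(z)] is [u_J(z)] times a Fejer kernel at [z^N]. The mean of [u_J] stays 1,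
but the Fejer kernel is small off a small set, hence the mean of [exp(-2 u_(J+1))],
which is the square norm of [exp(-h_(J+1))], is close to 1 ([mean_one_minus_exp]).
The step adds to [h_J] only frequencies beyond a gap [L_(J+1)], while the l1 norm of
[h_(J+1)] has a bound which does not depend on that gap ([l1_lac_step]). Therefore the
gap can be taken so large that [w_L] times [exp(2 C)], with [C] the bound of the l1
norms, is at most [2^-J]. With [p] close to [exp(h_K)], the product [b p] is close to
[exp(-(h - h_K))], whose coefficients between the gaps [L_(J+1)] and [L_(J+2)] are those
of [exp(h_K - h_(J+1))] and contribute at most [2^-J] to the weighted sum
([ratio_weighted]); summing over [J >= K] gives cyclicity ([limit_cyclic]).

Means over the circle are replaced by means over the [M]-th roots of unity, which are
exact for polynomials of size at most [M], and exponentials by their Taylor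
polynomials. *)

Set Implicit Arguments.
Unset Strict Implicit.
Unset Printing Implicit Defensive.

Import Order.TTheory GRing.Theory Num.Theory Num.Def.
Import numFieldNormedType.Exports.
Import ComplexField.Normc.

Local Open Scope classical_set_scope.
Local Open Scope complex_scope.
Local Open Scope ring_scope.

(** * Moduli of complex numbers *)

Lemma normc_ge0 (R : rcfType) (z : R[i]) : 0 <= normc z.
Proof. by case: z => a b; exact: sqrtr_ge0. Qed.

Lemma norm_normc (R : rcfType) (z : R[i]) : `|z| = (normc z)%:C.
Proof. by case: z => a b; rewrite normc_def. Qed.

Lemma norm_le_real (R : rcfType) (z : R[i]) (r : R) : (`|z| <= r%:C) = (normc z <= r).
Proof. by rewrite norm_normc lecR. Qed.

Lemma normcD (R : rcfType) (x y : R[i]) : normc (x + y) <= normc x + normc y.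
Proof. exact: le_normcD. Qed.

Lemma normcB (R : rcfType) (x y : R[i]) : normc (x - y) <= normc x + normc y.
Proof. by rewrite (le_trans (normcD _ _))// lerD2l; have := @normcN R y => ->. Qed.

Lemma normcBC (R : rcfType) (x y : R[i]) : normc (x - y) = normc (y - x).
Proof. by rewrite -opprB; exact: normcN. Qed.

Lemma normc_sum (R : rcfType) (I : Type) (r : seq I) (P : pred I) (F : I -> R[i]) :
  normc (\sum_(i <- r | P i) F i) <= \sum_(i <- r | P i) normc (F i).
Proof.
elim/big_ind2 : _ => [|x a y b xa yb|//]; first by rewrite normc0.
by rewrite (le_trans (normcD _ _))// lerD.
Qed.

Lemma normcX (R : rcfType) (z : R[i]) n : normc (z ^+ n) = normc z ^+ n.
Proof. by elim: n => [|n IH]; rewrite ?expr0 ?normc1// !exprS normcM IH. Qed.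

Lemma normcR (R : rcfType) (x : R) : normc (x%:C) = `|x|.
Proof. by rewrite /normc /= expr0n addr0 sqrtr_sqr. Qed.

Lemma normc_nat (R : rcfType) n : normc (n%:R : R[i]) = n%:R.
Proof.
by rewrite -[n%:R in LHS](rmorph_nat (@real_complex R)) normcR ger0_norm.
Qed.

Lemma normc_conj (R : rcfType) (z : R[i]) : normc (z^*) = normc z.
Proof. by case: z => a b /=; rewrite sqrrN. Qed.

Lemma sqr_normcE (R : rcfType) (z : R[i]) : ((normc z) ^+ 2)%:C = z * z^*.
Proof. by rewrite rmorphXn /= -norm_normc sqr_normc. Qed.

Lemma Re_normc (R : rcfType) (z : R[i]) : `|complex.Re z| <= normc z.
Proof.
by case: z => a b /=; rewrite -sqrtr_sqr ler_wsqrtr// lerDl sqr_ge0.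
Qed.

Lemma Im_normc (R : rcfType) (z : R[i]) : `|complex.Im z| <= normc z.
Proof.
by case: z => a b /=; rewrite -sqrtr_sqr ler_wsqrtr// lerDr sqr_ge0.
Qed.

Lemma normc_ReIm (R : rcfType) (z : R[i]) :
  normc z <= `|complex.Re z| + `|complex.Im z|.
Proof.
case: z => a b /=; have -> : `|a| + `|b| = Num.sqrt ((`|a| + `|b|) ^+ 2).
  by rewrite sqrtr_sqr [RHS]ger0_norm// addr_ge0.
apply: ler_wsqrtr; rewrite sqrrD !real_normK ?num_real//.
by rewrite addrAC lerDl mulrn_wge0// mulr_ge0.
Qed.

Lemma ReD (R : rcfType) (x y : R[i]) : complex.Re (x + y) = complex.Re x + complex.Re y.
Proof. by case: x y => [? ?] [? ?]. Qed.

Lemma Re_sum (R : rcfType) (I : Type) (r : seq I) (P : pred I) (F : I -> R[i]) :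
  complex.Re (\sum_(i <- r | P i) F i) = \sum_(i <- r | P i) complex.Re (F i).
Proof. by elim/big_ind2 : _ => // x a y b <- <-; exact: ReD. Qed.

Lemma Re_realM (R : rcfType) (x : R) (y : R[i]) : complex.Re (x%:C * y) = x * complex.Re y.
Proof. by case: y => [? ?] /=; rewrite mul0r subr0. Qed.

Lemma addc_conj (R : rcfType) (z : R[i]) : z + z^* = (2 * complex.Re z)%:C.
Proof. by case: z => a b; apply/eqP; rewrite eq_complex /= subrr mulrDl mul1r !eqxx. Qed.

Lemma conjcX (R : rcfType) (z : R[i]) n : (z ^+ n)^* = (z^*) ^+ n.
Proof. exact: rmorphXn. Qed.

(** * Averages over roots of unity *)

Lemma prim_root_exists (R : rcfType) (n : nat) : (0 < n)%N ->
  exists z : R[i], n.-primitive_root z.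
Proof.
move=> n_gt0.
pose p : {poly R[i]} := 'X^n - 1; have [r Dp] := closed_field_poly_normal p.
rewrite (monicP _) ?monicXnsubC // scale1r in Dp.
have rn1 : all n.-unity_root r by apply/allP=> z; rewrite -root_prod_XsubC -Dp.
have sz_r : (n < (size r).+1)%N.
  by rewrite -(size_prod_XsubC r id) -Dp size_XnsubC.
have [|z] := hasP (has_prim_root n_gt0 rn1 _ sz_r); last by exists z.
by rewrite -separable_prod_XsubC -Dp separable_Xn_sub_1 // pnatr_eq0 -lt0n.
Qed.

Lemma prim_root_normc (R : rcfType) (n : nat) (z : R[i]) :
  n.-primitive_root z -> normc z = 1.
Proof.
move=> pz; have n0 := prim_order_gt0 pz.
have := congr1 (@normc R) (prim_expr_order pz); rewrite normcX normc1.
by move=> /eqP; rewrite pexpr_eq1 ?normc_ge0// => /eqP.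
Qed.

Lemma unimod_conj (R : rcfType) (z : R[i]) : normc z = 1 -> z * z^* = 1.
Proof. by move=> z1; rewrite -sqr_normcE z1 expr1n. Qed.

(** Orthogonality of characters; it is the discrete counterpart of integrating
    [z^a conj(z)^b] over the circle. *)
Lemma sum_prim_root (R : rcfType) (M : nat) (w : R[i]) (a b : nat) :
  M.-primitive_root w ->
  \sum_(j < M) (w ^+ j) ^+ a * ((w ^+ j)^*) ^+ b =
  if (a == b %[mod M])%N then M%:R else 0.
Proof.
move=> pw; have wc := unimod_conj (prim_root_normc pw).
have M0 := prim_order_gt0 pw.
have -> : \sum_(j < M) (w ^+ j) ^+ a * ((w ^+ j)^*) ^+ b =
          \sum_(j < M) (w ^+ a * (w^*) ^+ b) ^+ j.
  apply: eq_bigr => j _; rewrite conjcX exprMn -!exprM.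
  by rewrite (mulnC j) (mulnC j).
case: eqP => [ab|ab].
  rewrite (eq_bigr (fun=> 1)) ?sumr_const ?card_ord// => j _.
  have -> : w ^+ a = w ^+ b by apply/eqP; rewrite (eq_prim_root_expr pw); apply/eqP.
  by rewrite -exprMn wc !expr1n.
set q := w ^+ a * _.
have q1 : q != 1.
  apply/eqP => q1; apply: ab; apply/eqP; rewrite -(eq_prim_root_expr pw).
  have := congr1 (fun x => x * w ^+ b) q1.
  by rewrite /q mul1r -mulrA -exprMn (mulrC _ w) wc expr1n mulr1 => ->.
have := subrX1 q M.
have -> : q ^+ M = 1.
  rewrite /q exprMn -!exprM !(mulnC _ M) !exprM (prim_expr_order pw).
  by rewrite -conjcX (prim_expr_order pw) rmorph1 !expr1n mulr1.
by rewrite subrr => /esym/eqP; rewrite mulf_eq0 subr_eq0 (negbTE q1) => /eqP.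
Qed.

(** * Limits with explicit error bounds *)

(** The intervals [[u_n - e_n, u_n + e_n]] meet pairwise, so they share the point
    [sup (u_n - e_n)]. *)
Lemma dominated_cauchy (R : realType) (u e : nat -> R) :
  (forall n m, (n <= m)%N -> `|u m - u n| <= e n) ->
  exists s, forall n, `|s - u n| <= e n.
Proof.
move=> ue.
have cross n m : u n - e n <= u m + e m.
  have [nm|/ltnW mn] := leqP n m.
    have := ue _ _ nm; rewrite ler_norml => /andP[h _].
    have h2 := le_trans (normr_ge0 _) (ue _ _ (leqnn m)).
    lra.
  have := ue _ _ mn; rewrite ler_norml => /andP[_ h].
  have h2 := le_trans (normr_ge0 _) (ue _ _ (leqnn n)).
  lra.
pose E := [set u n - e n | n in setT].
have ubE m : ubound E (u m + e m) by move=> _ [n _ <-]; exact: cross.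
have E0 : E !=set0 by exists (u 0%N - e 0%N); exists 0%N.
exists (sup E) => n; rewrite ler_norml; apply/andP; split.
  have : u n - e n <= sup E.
    by apply: ub_le_sup; [exists (u 0%N + e 0%N); exact: ubE | exists n].
  lra.
have : sup E <= u n + e n by apply: ge_sup.
lra.
Qed.

(** Real and imaginary parts are treated separately, whence the factor 2. *)
Lemma dominated_cauchyC (R : realType) (u : nat -> R[i]) (e : nat -> R) :
  (forall n m, (n <= m)%N -> normc (u m - u n) <= e n) ->
  exists s, forall n, normc (s - u n) <= 2 * e n.
Proof.
move=> ue.
have [n m nm|x hx] := @dominated_cauchy R (fun n => complex.Re (u n)) e.
  apply: le_trans (ue _ _ nm); apply: le_trans (Re_normc _).
  by case: (u m) (u n) => [? ?] [? ?].
have [n m nm|y hy] := @dominated_cauchy R (fun n => complex.Im (u n)) e.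
  apply: le_trans (ue _ _ nm); apply: le_trans (Im_normc _).
  by case: (u m) (u n) => [? ?] [? ?].
exists (x +i* y) => n; apply: le_trans (normc_ReIm _) _.
rewrite mulrDl mul1r; move: (hx n) (hy n).
by case: (u n) => a b /= h1 h2; apply: lerD.
Qed.

Lemma le_null (R : realType) (x y : R) (e : nat -> R) :
  e n @[n --> \oo] --> (0 : R) -> (forall n, x <= y + e n) -> x <= y.
Proof.
move=> e0 xy.
have h : (y + e n) @[n --> \oo] --> y + 0 by apply: cvgD => //; exact: cvg_cst.
rewrite -[y]addr0; rewrite -(cvg_lim _ h)//.
by apply: limr_ge; [apply/cvg_ex; exists (y + 0) | near=> n; exact: xy].
Unshelve. all: by end_near. Qed.

Lemma cvg_normc_sqr (R : realType) (u : nat -> R[i]) (v : R[i]) :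
  normc (v - u n) @[n --> \oo] --> (0 : R) ->
  normc (u n) ^+ 2 @[n --> \oo] --> normc v ^+ 2.
Proof.
move=> uv; suff c : normc (u n) @[n --> \oo] --> normc v.
  by under eq_fun do rewrite expr2; rewrite expr2; exact: cvgM.
apply/cvgrPdist_le => e e0; near=> n.
have hn : normc (v - u n) <= e.
  near: n; have /cvgrPdist_le/(_ e e0) := uv; apply: filterS => n.
  by rewrite sub0r normrN ger0_norm ?normc_ge0.
have h1 := normcD (v - u n) (u n); have h2 := normcB v (v - u n).
rewrite subrK in h1; rewrite subKr in h2.
rewrite ler_norml; apply/andP; split; lra.
Unshelve. all: by end_near. Qed.

Lemma limr_le_null (R : realType) (u : nat -> R) (U c : R) (e : nat -> R) :
  u n @[n --> \oo] --> U -> e n @[n --> \oo] --> (0 : R) ->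
  (forall n, u n <= c + e n) -> U <= c.
Proof.
move=> uU e0 h1; have h2 : (u n - e n) @[n --> \oo] --> U - 0 by exact: cvgB.
rewrite -[U]subr0 -(cvg_lim _ h2)//.
apply: limr_le; first by apply/cvg_ex; exists (U - 0).
by near=> n; rewrite lerBlDr.
Unshelve. all: by end_near. Qed.

Lemma null_geo (R : realType) (K q : R) : 0 <= q < 1 ->
  K * q ^+ n @[n --> \oo] --> (0 : R).
Proof.
move=> /andP[q0 q1]; rewrite -[X in _ --> X](mulr0 K); apply: cvgMr.
by apply: cvg_expr; rewrite ger0_norm.
Qed.

Lemma null_add (R : realType) (e f : nat -> R) :
  e n @[n --> \oo] --> (0 : R) -> f n @[n --> \oo] --> (0 : R) ->
  e n + f n @[n --> \oo] --> (0 : R).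
Proof. by move=> e0 f0; rewrite -[X in _ --> X](addr0 0); exact: cvgD. Qed.

Lemma null_shift (R : realType) (e : nat -> R) :
  e n @[n --> \oo] --> (0 : R) -> e n.+1 @[n --> \oo] --> (0 : R).
Proof. by move=> e0; rewrite (cvg_shiftS e). Qed.

Lemma null_ex (R : realType) (e : nat -> R) (eps : R) :
  e n @[n --> \oo] --> (0 : R) -> 0 < eps ->
  exists N, forall n, (N <= n)%N -> e n <= eps.
Proof.
move=> e0 eps0; have /cvgrPdist_le/(_ _ eps0)[N _ hN] := e0.
exists N => n Nn; have := hN n Nn; rewrite sub0r normrN; exact: le_trans (ler_norm _).
Qed.

Lemma null_sum (R : realType) (T : eqType) (s : seq T) (F : T -> nat -> R) :
  (forall p, p \in s -> F p n @[n --> \oo] --> (0 : R)) ->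
  \sum_(p <- s) F p n @[n --> \oo] --> (0 : R).
Proof.
elim: s => [|x s IH] hF; first by under eq_fun do rewrite big_nil; exact: cvg_cst.
under eq_fun do rewrite big_cons; apply: null_add; first by apply: hF; rewrite mem_head.
by apply: IH => p ps; apply: hF; rewrite inE ps orbT.
Qed.

(** The bound telescopes: with [a = 1/(1 - q)] and
    [P k = a k^2 + 2 a^2 k + 3 a^3] one has
    [k^2 q^k <= P k q^k - P (k + 1) q^(k + 1)]. *)
Lemma sum_sqr_geo (R : realType) (q : R) n : 0 <= q < 1 ->
  \sum_(k < n) k%:R ^+ 2 * q ^+ k <= 3 / (1 - q) ^+ 3.
Proof.
move=> /andP[q0 q1]; have p0 : 0 < 1 - q by lra.
pose a := (1 - q)^-1; have a0 : 0 < a by rewrite invr_gt0.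
have qa : (1 - q) * a = 1 by rewrite divff// gt_eqF.
pose P (k : nat) := a * k%:R ^+ 2 + 2 * a ^+ 2 * k%:R + 3 * a ^+ 3.
suff : \sum_(k < n) k%:R ^+ 2 * q ^+ k + P n * q ^+ n <= 3 * a ^+ 3.
  rewrite /a exprVn => h; apply: le_trans h; rewrite lerDl mulr_ge0 ?exprn_ge0//.
  have ha := ltW a0; by rewrite /P !addr_ge0// !mulr_ge0// exprn_ge0.
elim: n => [|n IH]; first by rewrite big_ord0 /P expr0 !mulr1 expr0n !mulr0 !add0r.
rewrite big_ord_recr /=; apply: le_trans IH; rewrite -addrA lerD2l.
rewrite [q ^+ n.+1]exprS mulrA -mulrDl ler_wpM2r ?exprn_ge0//.
rewrite /P -natr1; set x := n%:R; have x0 : 0 <= x by rewrite ler0n.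
have qE : q * a = a - 1 by lra.
have -> : (a * (x + 1) ^+ 2 + 2 * a ^+ 2 * (x + 1) + 3 * a ^+ 3) * q =
  (a - 1) * ((x + 1) ^+ 2 + 2 * a * (x + 1) + 3 * a ^+ 2).
  by rewrite -qE; ring.
have a1 : 1 <= a by rewrite /a invf_ge1//; lra.
nra.
Qed.

Lemma sum_geo_le (R : realType) (q : R) n m : 0 <= q < 1 ->
  \sum_(n <= k < m) q ^+ k <= q ^+ n / (1 - q).
Proof.
move=> /andP[q0 q1]; have p0 : 0 < 1 - q by lra.
have [nm|/ltnW mn] := leqP n m; last first.
  by rewrite big_geq// divr_ge0 ?exprn_ge0// ltW.
suff : \sum_(n <= k < m) q ^+ k + q ^+ m / (1 - q) <= q ^+ n / (1 - q).
  by apply: le_trans; rewrite lerDl divr_ge0 ?exprn_ge0// ltW.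
rewrite -(subnKC nm); elim: (m - n)%N => [|k IH]; first by rewrite addn0 big_geq// add0r.
rewrite addnS big_nat_recr ?leq_addr//=; apply: le_trans IH.
rewrite -addrA lerD2l -(@ler_pM2r _ (1 - q))// mulrDl !mulfVK ?gt_eqF//.
by rewrite exprS; lra.
Qed.

Lemma sub_partial_sums (R : realType) (a : nat -> R[i]) n m :
  (n <= m)%N -> \sum_(k < m) a k - \sum_(k < n) a k = \sum_(n <= k < m) a k.
Proof.
move=> nm; rewrite -!(big_mkord xpredT a) (@big_cat_nat _ _ _ n 0 m)//=.
by rewrite addrAC subrr add0r.
Qed.

Lemma sum_ord_split (R : numDomainType) (u : nat -> R) M N : (forall l, 0 <= u l) ->
  \sum_(l < N) u l <= \sum_(l < M) u l + \sum_(M <= l < N) u l.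
Proof.
move=> u0; rewrite -!(big_mkord xpredT u).
have [NM|/ltnW MN] := leqP N M.
  rewrite [X in _ + X]big_geq// addr0 (@big_cat_nat _ _ _ N 0 M)//= lerDl sumr_ge0//.
by rewrite (@big_cat_nat _ _ _ M 0 N).
Qed.

Lemma sum_sqr_le (R : realFieldType) (n : nat) (u : nat -> R) : (forall k, 0 <= u k) ->
  \sum_(k < n) u k ^+ 2 <= (\sum_(k < n) u k) ^+ 2.
Proof.
move=> u0; elim: n => [|n IH]; first by rewrite !big_ord0 expr0n.
rewrite !big_ord_recr /=; set S := \sum_(i < n) u i in IH *.
have S0 : 0 <= S by rewrite /S sumr_ge0.
have := u0 n; nra.
Qed.

(** Cauchy products are summed over [{(j, n) | j <= n < N}], either by [n] or by
    [j]. *)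
Lemma triangle_sum (V : nmodType) (G : nat -> nat -> V) N :
  \sum_(n < N) \sum_(j < n.+1) G j (n - j)%N = \sum_(j < N) \sum_(i < N - j) G j i.
Proof.
elim: N => [|N IH]; first by rewrite !big_ord0.
rewrite big_ord_recr /= IH.
have -> : \sum_(j < N) \sum_(i < N - j) G j i = \sum_(j < N.+1) \sum_(i < N - j) G j i.
  by rewrite big_ord_recr /= subnn big_ord0 addr0.
rewrite -big_split /=; apply: eq_bigr => j _.
have jN : (j <= N)%N by rewrite -ltnS.
by rewrite subSn// big_ord_recr.
Qed.

(** * Power series *)

Definition radius_ge (R : realType) (rho : R) (a : nat -> R[i]) :=
  forall r, 0 < r < rho -> exists A, forall n, normc (a n) * r ^+ n <= A.

(** Convergence is required at a geometric rate, so that sums of power series can be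
    compared without moving limits around. *)
Definition sums_to (R : realType) (a : nat -> R[i]) (z s : R[i]) :=
  exists K q, 0 <= q < 1 /\
    forall n, normc (s - \sum_(k < n) a k * z ^+ k) <= K * q ^+ n.

Definition has_power_series (R : realType) (rho : R) (a : nat -> R[i]) (f : R[i] -> R[i]) :=
  radius_ge rho a /\ forall z, normc z < rho -> sums_to a z (f z).

Lemma sums_to_exists (R : realType) (rho : R) (a : nat -> R[i]) z :
  radius_ge rho a -> normc z < rho -> exists s, sums_to a z s.
Proof.
move=> ra zr; pose r := (normc z + rho) / 2.
have z0 := normc_ge0 z.
have r0 : 0 < r by rewrite /r; lra.
have zr' : normc z < r by rewrite /r; lra.
have [|A hA] := ra r; first by rewrite r0 /r /=; lra.
pose q := normc z / r.
have q01 : 0 <= q < 1.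
  by rewrite divr_ge0 ?(ltW r0)//= ltr_pdivrMr// mul1r.
have term k : normc (a k * z ^+ k) <= A * q ^+ k.
  rewrite normcM normcX /q expr_div_n mulrA ler_pdivlMr ?exprn_gt0//.
  by rewrite mulrAC ler_wpM2r ?exprn_ge0.
have A0 : 0 <= A by apply: le_trans (hA 0%N); rewrite mulr_ge0 ?normc_ge0 ?exprn_ge0 ?ltW.
have [n m nm|s hs] := @dominated_cauchyC R (fun n => \sum_(k < n) a k * z ^+ k)
   (fun n => A / (1 - q) * q ^+ n).
  rewrite (@sub_partial_sums _ (fun k => a k * z ^+ k))//.
  apply: le_trans (normc_sum _ _ _) _.
  apply: le_trans (ler_sum _ (fun k _ => term k)) _.
  rewrite -mulr_sumr -mulrA ler_wpM2l// mulrC; exact: sum_geo_le.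
exists s, (2 * (A / (1 - q))), q; split => // n.
by rewrite -mulrA.
Qed.

Lemma power_series_exists (R : realType) (rho : R) (a : nat -> R[i]) :
  radius_ge rho a -> exists f, has_power_series rho a f.
Proof.
move=> ra.
have /choice[f hf] : forall z, exists s, normc z < rho -> sums_to a z s.
  move=> z; have [zr|zr] := boolP (normc z < rho).
    by have [s hs] := sums_to_exists ra zr; exists s.
  by exists 0.
by exists f; split.
Qed.

Definition dcoef (R : realType) (a : nat -> R[i]) (n : nat) : R[i] :=
  n.+1%:R * a n.+1.

Lemma radius_dcoef (R : realType) (rho : R) (a : nat -> R[i]) :
  radius_ge rho a -> radius_ge rho (dcoef a).
Proof.
move=> ra r /andP[r0 rr]; pose r' := (r + rho) / 2.
have r'0 : 0 < r' by rewrite /r'; lra.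
have [|A hA] := ra r'; first by rewrite r'0 /r' /=; lra.
pose q := r / r'.
have q01 : 0 <= q < 1.
  by rewrite divr_ge0 ?(ltW r0) ?(ltW r'0)//= ltr_pdivrMr// mul1r /r'; lra.
have A0 : 0 <= A by apply: le_trans (hA 0%N); rewrite mulr_ge0 ?normc_ge0 ?exprn_ge0 ?ltW.
exists (A / r * (3 / (1 - q) ^+ 3)) => n; rewrite /dcoef normcM normc_nat.
have rE : r = r' * q by rewrite /q mulrC mulfVK// gt_eqF.
have sq : n.+1%:R * q ^+ n.+1 <= 3 / (1 - q) ^+ 3.
  apply: le_trans (sum_sqr_geo n.+2 q01); rewrite big_ord_recr /=.
  rewrite -[leLHS]add0r lerD ?sumr_ge0// => [i _|].
    by rewrite mulr_ge0 ?exprn_ge0//; case/andP: q01.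
  rewrite ler_wpM2r ?exprn_ge0//; first by case/andP: q01.
  by rewrite expr2 ler_peMr// ler1n.
have -> : n.+1%:R * normc (a n.+1) * r ^+ n =
  (normc (a n.+1) * r' ^+ n.+1) / r * (n.+1%:R * q ^+ n.+1).
  have -> : r ^+ n = r ^+ n.+1 / r by rewrite exprSr mulfK// gt_eqF.
  rewrite {1}rE exprMn; ring.
apply: ler_pM => //.
- by rewrite divr_ge0 ?(ltW r0)// mulr_ge0 ?normc_ge0// exprn_ge0// ltW.
- by rewrite mulr_ge0// exprn_ge0//; case/andP: q01.
- by rewrite ler_pM2r ?invr_gt0.
Qed.

(** The remainders [T_n] satisfy [T_(n+1) = (z + h) T_n + n h^2 z^(n-1)]. *)
Lemma pow_taylor2 (R : rcfType) (z h : R[i]) (r : R) n :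
  normc z <= r -> normc (z + h) <= r ->
  r ^+ 2 * normc ((z + h) ^+ n - z ^+ n - h * (n%:R * z ^+ n.-1)) <=
  n%:R ^+ 2 * r ^+ n * normc h ^+ 2.
Proof.
move=> zr zhr; have r0 : 0 <= r := le_trans (normc_ge0 _) zr.
elim: n => [|n IH].
  by rewrite !expr0 mul0r mulr0 !subrr normc0 mulr0 expr0n !mul0r.
have -> : (z + h) ^+ n.+1 - z ^+ n.+1 - h * (n.+1%:R * z ^+ n.+1.-1) =
  (z + h) * ((z + h) ^+ n - z ^+ n - h * (n%:R * z ^+ n.-1)) +
  h ^+ 2 * (n%:R * z ^+ n.-1).
  case: n {IH} => [|n]; first by rewrite /= !expr1 !expr0; ring.
  by rewrite /= !exprS -!natr1; ring.
apply: (@le_trans _ _ (r * (n%:R ^+ 2 * r ^+ n * normc h ^+ 2) +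
   normc h ^+ 2 * (n%:R * r ^+ n.+1))).
  apply: le_trans (ler_wpM2l _ (normcD _ _)) _; first exact: exprn_ge0.
  rewrite mulrDr; apply: lerD.
    rewrite normcM mulrCA ler_pM// ?normc_ge0//.
    by rewrite mulr_ge0 ?exprn_ge0 ?normc_ge0.
  rewrite normcM normcX mulrCA ler_wpM2l ?exprn_ge0 ?normc_ge0//.
  rewrite normcM normcX normc_nat mulrCA.
  case: n {IH} => [|n]; first by rewrite !mul0r.
  rewrite ler_wpM2l//= -[n.+2]addn2 exprD mulrC ler_wpM2r ?exprn_ge0//.
  by rewrite lerXn2r ?nnegrE ?normc_ge0.
rewrite -natr1; set x := n%:R; have x0 : 0 <= x by rewrite ler0n.
have H : 0 <= normc h ^+ 2 * r ^+ n.+1 by rewrite mulr_ge0 ?exprn_ge0 ?normc_ge0.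
have -> : r * (x ^+ 2 * r ^+ n * normc h ^+ 2) + normc h ^+ 2 * (x * r ^+ n.+1) =
  (x ^+ 2 + x) * (normc h ^+ 2 * r ^+ n.+1).
  by rewrite [r ^+ n.+1]exprS; ring.
have -> : (x + 1) ^+ 2 * r ^+ n.+1 * normc h ^+ 2 =
  (x + 1) ^+ 2 * (normc h ^+ 2 * r ^+ n.+1) by ring.
by apply: ler_wpM2r => //; nra.
Qed.

Lemma sums_toP (R : realType) (a : nat -> R[i]) z s :
  sums_to a z s -> exists2 e : nat -> R, e n @[n --> \oo] --> (0 : R) &
    forall n, normc (s - \sum_(k < n) a k * z ^+ k) <= e n.
Proof.
move=> [K [q [q01 h]]]; exists (fun n => K * q ^+ n) => //; exact: null_geo.
Qed.

(** Termwise second order estimates are summed; the circle of radius [r'] between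
    [|z|] and [rho] makes the sum of the remainders converge. *)
Lemma power_series_taylor2 (R : realType) (rho : R) (a : nat -> R[i]) (f g : R[i] -> R[i]) z :
  has_power_series rho a f -> has_power_series rho (dcoef a) g -> normc z < rho ->
  exists K d, 0 < d /\
   forall h, normc h <= d -> normc (f (z + h) - f z - h * g z) <= K * normc h ^+ 2.
Proof.
move=> [ra fa] [_ ga] zr; have z0 := normc_ge0 z.
(* The circles of radii [|z|, r, r', rho] are equally spaced; [z + h] stays within [r]. *)
pose d := (rho - normc z) / 3; have d0 : 0 < d by rewrite /d; lra.
pose r := normc z + d; pose r' := r + d.
have r0 : 0 < r by rewrite /r; lra.
have r'0 : 0 < r' by rewrite /r'; lra.
have [|A hA] := ra r'; first by rewrite r'0 /r' /r /d /=; lra.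
pose q := r / r'.
have q01 : 0 <= q < 1.
  by rewrite divr_ge0 ?(ltW r0) ?(ltW r'0)//= ltr_pdivrMr// mul1r /r'; lra.
have rE : r = r' * q by rewrite /q mulrC mulfVK// gt_eqF.
exists (A * (3 / (1 - q) ^+ 3) / r ^+ 2), d; split => // h hd.
have zh : normc (z + h) <= r by apply: le_trans (normcD _ _) _; rewrite /r lerD2l.
have zhr : normc (z + h) < rho by apply: le_lt_trans zh _; rewrite /r /d; lra.
have [e1 e10 h1] := sums_toP (fa _ zhr).
have [e2 e20 h2] := sums_toP (fa _ zr).
have [e3 e30 h3] := sums_toP (ga _ zr).
have A0 : 0 <= A by apply: le_trans (hA 0%N); rewrite mulr_ge0 ?normc_ge0 ?exprn_ge0 ?ltW.
apply: (@le_null _ _ _ (fun n => e1 n.+1 + e2 n.+1 + normc h * e3 n)).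
  apply: null_add; first by apply: null_add; exact: null_shift.
  rewrite -[X in _ --> X](mulr0 (normc h)); exact: cvgMr.
move=> n.
pose S1 := \sum_(k < n.+1) a k * (z + h) ^+ k.
pose S2 := \sum_(k < n.+1) a k * z ^+ k.
pose S3 := \sum_(k < n) dcoef a k * z ^+ k.
pose T := \sum_(k < n.+1) a k * ((z + h) ^+ k - z ^+ k - h * (k%:R * z ^+ k.-1)).
have TE : T = S1 - S2 - h * S3.
  rewrite /T /S1 /S2 -sumrB.
  have -> : h * S3 = \sum_(k < n.+1) a k * (h * (k%:R * z ^+ k.-1)).
    rewrite big_ord_recl /= mul0r !mulr0 add0r mulr_sumr; apply: eq_bigr => k _.
    by rewrite /dcoef /bump /=; ring.
  by rewrite -sumrB; apply: eq_bigr => k _; ring.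
have -> : f (z + h) - f z - h * g z =
  T + ((f (z + h) - S1) - (f z - S2) - h * (g z - S3)) by rewrite TE; ring.
apply: le_trans (normcD _ _) _; apply: lerD.
  apply: le_trans (normc_sum _ _ _) _.
  rewrite mulrAC ler_pdivlMr ?exprn_gt0// mulrC mulr_sumr.
  apply: (@le_trans _ _ (\sum_(k < n.+1) A * (k%:R ^+ 2 * q ^+ k) * normc h ^+ 2)).
    apply: ler_sum => k _; rewrite normcM mulrCA.
    apply: le_trans (ler_wpM2l (normc_ge0 _) (@pow_taylor2 _ z h r k _ zh)) _.
      by rewrite /r; lra.
    rewrite rE exprMn mulrA ler_wpM2r ?exprn_ge0 ?normc_ge0//.
    have -> : normc (a k) * (k%:R ^+ 2 * (r' ^+ k * q ^+ k)) =
      (normc (a k) * r' ^+ k) * (k%:R ^+ 2 * q ^+ k) by ring.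
    by apply: ler_wpM2r => //; rewrite mulr_ge0 ?exprn_ge0//; case/andP: q01.
  rewrite -mulr_suml -mulr_sumr ler_wpM2r ?exprn_ge0 ?normc_ge0// ler_wpM2l//.
  exact: sum_sqr_geo.
apply: le_trans (normcB _ _) _; apply: lerD.
  apply: le_trans (normcB _ _) _; apply: lerD; [exact: h1 | exact: h2].
by rewrite normcM ler_wpM2l ?normc_ge0 ?h3.
Qed.

(** A quadratic remainder makes the difference quotients converge. *)
Lemma diff_quotient (R : realType) (f : R[i] -> R[i]) (z l : R[i]) (K d : R) :
  0 < d ->
  (forall h, normc h <= d -> normc (f (z + h) - f z - h * l) <= K * normc h ^+ 2) ->
  (h^-1 *: ((f (h + z) : R[i]^o) - f z)) @[h --> (0 : R[i]^o)^'] --> (l : R[i]^o).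
Proof.
move=> d0 hf; apply/cvgrPdist_le => e e0.
have [e' e'0 ee'] : exists2 e' : R, 0 < e' & e'%:C <= e.
  case: e e0 => u v; rewrite ltcE /= => /andP[/eqP v0 u0]; exists u => //.
  by rewrite lecE /= v0 eqxx lexx.
pose K' := `|K| + 1; have K'0 : 0 < K' by rewrite /K' ltr_wpDl.
pose m := Num.min d (e' / K').
have m0 : 0 < m by rewrite lt_min d0 divr_gt0.
apply/nbhs_ballP; exists (m%:C); first by rewrite /= ltcR.
move=> h; rewrite -ball_normE /= sub0r normrN norm_normc ltcR => /ltW hm h0.
apply: le_trans ee'; rewrite norm_le_real.
have -> : l - h^-1 *: ((f (h + z) : R[i]^o) - f z) =
   - (h^-1 * (f (z + h) - f z - h * l)).
  by rewrite /GRing.scale /= (addrC h z); field.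
rewrite normcN normcM normcV.
move: hm; rewrite le_min => /andP[hd he].
have nh0 : 0 < normc h.
  rewrite lt_def normc_ge0 andbT; apply: contra h0 => /eqP/eq0_normc ->//.
rewrite mulrC ler_pdivrMr//; apply: le_trans (hf _ hd) _.
rewrite expr2 mulrA ler_wpM2r ?normc_ge0//.
apply: (@le_trans _ _ (K' * normc h)).
  by rewrite ler_wpM2r ?normc_ge0// /K' ler_wpDr// ler_norm.
by rewrite mulrC -ler_pdivlMr.
Qed.

Lemma power_series_derive1 (R : realType) (rho : R) (a : nat -> R[i]) (f g : R[i] -> R[i]) z :
  has_power_series rho a f -> has_power_series rho (dcoef a) g -> normc z < rho ->
  derivable (f : R[i]^o -> R[i]^o) z 1 /\ derive1 (f : R[i] -> R[i]^o) z = g z.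
Proof.
move=> pf pg zr; have [K [d [d0 hf]]] := power_series_taylor2 pf pg zr.
have cv := diff_quotient d0 hf.
split; last by apply: cvg_lim.
apply/cvg_ex; exists (g z).
suff -> : (fun h : R[i]^o => h^-1 *: (((f : R[i]^o -> R[i]^o) \o shift z) (h *: (1 : R[i]^o)) - f z)) =
  (fun h => h^-1 *: ((f (h + z) : R[i]^o) - f z)) by [].
by apply/funext => h /=; rewrite /GRing.scale /= mulr1.
Qed.

Lemma power_series_derivable (R : realType) (rho : R) (a : nat -> R[i]) (f : R[i] -> R[i]) z :
  has_power_series rho a f -> normc z < rho -> derivable (f : R[i]^o -> R[i]^o) z 1.
Proof.
move=> pf zr; have [g pg] := power_series_exists (radius_dcoef pf.1).
by have [] := power_series_derive1 pf pg zr.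
Qed.

(** Only the values on the disc of convergence matter for the derivative there, so the
    derivative of [f] inherits the power series of any function with the derived
    coefficients. *)
Lemma power_series_derive1n (R : realType) (rho : R) (a : nat -> R[i]) (f : R[i] -> R[i]) n :
  has_power_series rho a f -> has_power_series rho (iter n (@dcoef R) a) (derive1n n (f : R[i] -> R[i]^o)).
Proof.
move=> pf; elim: n => [//|n IH]; rewrite iterS derive1nS.
have [g pg] := power_series_exists (radius_dcoef IH.1).
split; first exact: pg.1.
move=> z zr; have [_ ->] := power_series_derive1 IH pg zr; exact: pg.2.
Qed.

Lemma iter_dcoef0 (R : realType) (a : nat -> R[i]) n k :
  iter n (@dcoef R) a k = (\prod_(k <= j < k + n) j.+1%:R) * a (k + n)%N.
Proof.
elim: n k => [|n IH] k; first by rewrite addn0 big_geq// mul1r.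
rewrite iterS /dcoef IH addSnnS mulrA; congr (_ * _).
by rewrite [in RHS]big_ltn // addnS ltnS leq_addr.
Qed.

Lemma taylor_coef_power_series (R : realType) (rho : R) (a : nat -> R[i]) (f : R[i] -> R[i]) n :
  0 < rho -> has_power_series rho a f -> taylor_coef f n = a n.
Proof.
move=> rho0 pf; rewrite /taylor_coef.
have [_ /(_ 0)] := power_series_derive1n n pf; rewrite normc0 => /(_ rho0)/sums_toP[e e0 he].
have -> : derive1n n (f : R[i] -> R[i]^o) 0 = n`!%:R * a n.
  apply/eqP; rewrite -subr_eq0; apply/eqP/(@eq0_normc R); apply/eqP.
  rewrite eq_le normc_ge0 andbT; apply: (le_null (null_shift e0)) => m.
  rewrite add0r; apply: le_trans (he m.+1).
  rewrite big_ord_recl expr0 mulr1 big1 => [|i _]; last by rewrite expr0n /= mulr0.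
  rewrite addr0 iter_dcoef0 add0n.
  suff -> : \prod_(0 <= j < n) (j.+1%:R : R[i]) = n`!%:R by [].
  elim: n {e e0 he m} => [|n IH]; first by rewrite big_geq.
  by rewrite big_nat_recr//= IH factS natrM mulrC.
by rewrite mulrC mulKf// pnatr_eq0 -lt0n fact_gt0.
Qed.

(** * Finite combinations of point evaluations *)

(** The list [(c_1, l_1), ..., (c_k, l_k)] stands for the combination of evaluations
    [phi |-> sum c_i phi(l_i)]. *)
Definition act (R : rcfType) (mu : seq (R[i] * R[i])) (phi : R[i] -> R[i]) : R[i] :=
  \sum_(p <- mu) p.1 * phi p.2.

Definition in_disc (R : rcfType) (mu : seq (R[i] * R[i])) :=
  forall p, p \in mu -> normc p.2 < 1.

(** The usual argument, for a form on a space of arbitrary dimension: the form is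
    nonnegative on the component of [u] orthogonal to [v]. *)
Lemma ip_CauchySchwarz (R : realType) (H : lmodType R[i]) (ip : {dot H for conjC})
  (u v : H) : `|ip u v| ^+ 2 <= ip u u * ip v v.
Proof.
have [->|v0] := eqVneq v 0; first by rewrite !linear0r normr0 expr0n.
have vv0 : 0 < ip v v by rewrite dnorm_gt0.
have := dnorm_ge0 ip (u - (ip u v / ip v v) *: v).
set a := ip u v / ip v v.
have vu : ip v u = (ip u v)^* by rewrite hermC /= expr0 mul1r.
rewrite linearBl /= !linearBr /= !linearZl_LR /= !linearZr_LR /= vu.
have vvr : (ip v v)^* = ip v v by rewrite geC0_conj ?ltW.
set X := (X in 0 <= X).
have -> : X = ip u u - `|ip u v| ^+ 2 / ip v v.
  rewrite /X normCK /a rmorphM /= fmorphV /= vvr /GRing.scale /=; field; exact: lt0r_neq0.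
by rewrite subr_ge0 ler_pdivrMr.
Qed.

Lemma act_conj (R : rcfType) (mu nu : seq (R[i] * R[i])) (phi psi : R[i] -> R[i]) :
  act mu phi * (act nu psi)^* =
  \sum_(p <- mu) \sum_(q <- nu) p.1 * q.1^* * (phi p.2 * (psi q.2)^*).
Proof.
rewrite /act mulr_suml; apply: eq_bigr => p _.
rewrite rmorph_sum mulr_sumr; apply: eq_bigr => q _.
by rewrite rmorphM /=; ring.
Qed.

Section RKHS.
Variables (R : realType) (B : R[i] -> R[i]).
Variables (H : completeNormedModType R[i]) (ip : {dot H for conjC}).
Variables (ev : H -> R[i] -> R[i]).
Hypothesis rk : is_RKHS (dBR_kernel B) ip ev.

(** The combination is the pairing of [h] with [sum conj(c_i) k_(l_i)], whose squared norm
    is read off the kernel. *)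
Lemma act_ev_le (h : H) (mu : seq (R[i] * R[i])) : in_disc mu ->
  `|act mu (ev h)| ^+ 2 <=
  ip h h * \sum_(p <- mu) \sum_(q <- mu) p.1 * q.1^* * dBR_kernel B p.2 q.2.
Proof.
move=> dmu.
have /choice[k hk] : forall l, exists kl : H, unit_disc l ->
    (forall z, unit_disc z -> ev kl z = dBR_kernel B z l) /\
    (forall h, ev h l = ip h kl).
  move=> l; have [ld|] := pselect (unit_disc l); last by exists 0.
  by have [kl h1 h2] := rkhs_reproducing rk ld; exists kl.
have disc p : p \in mu -> unit_disc p.2.
  by move=> /dmu; rewrite /unit_disc /= norm_normc ltcR.
pose V := \sum_(p <- mu) p.1^* *: k p.2.
have hV g : ip g V = act mu (ev g).
  rewrite /V linear_sum; apply: eq_big_seq => p pmu /=.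
  by rewrite linearZr_LR /= conjCK (hk _ (disc _ pmu)).2.
have -> : act mu (ev h) = ip h V by rewrite hV.
apply: le_trans (ip_CauchySchwarz _ _ _) _.
have -> : ip V V = \sum_(p <- mu) \sum_(q <- mu) p.1 * q.1^* * dBR_kernel B p.2 q.2.
  rewrite hV /act; apply: eq_big_seq => p pmu.
  rewrite (hk _ (disc _ pmu)).2 /V.
  rewrite (big_morph (fun x => ip x (k p.2)) (id1 := 0) (op1 := +%R)) ?linear0l//; last first.
    by move=> x y; rewrite linearDl.
  rewrite mulr_sumr.
  apply: eq_big_seq => q qmu /=; rewrite linearZl_LR /= mulrA; congr (_ * _).
  by rewrite -(hk _ (disc _ pmu)).2 (hk _ (disc _ qmu)).1//; exact: disc.
exact: lexx.
Qed.

(** Expanding [1/(1 - l conj(l'))] as a geometric series splits the quadratic form of the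
    kernel into squares of moments; the tail beyond [N] decays because the finitely many
    points stay away from the circle. *)
Lemma rkhs_ineq (h : H) : exists2 hh : R, 0 <= hh & forall mu, in_disc mu ->
  exists2 e : nat -> R, e n @[n --> \oo] --> (0 : R) & forall N,
  normc (act mu (ev h)) ^+ 2 <=
  hh * (\sum_(n < N) (normc (act mu (fun z => z ^+ n)) ^+ 2 -
                      normc (act mu (fun z => B z * z ^+ n)) ^+ 2) + e N).
Proof.
have hh0 : 0 <= ip h h by exact: dnorm_ge0.
have hhE : ip h h = (complex.Re (ip h h))%:C.
  by move: hh0; case: (ip h h) => u v; rewrite lecE /= => /andP[/eqP-> _].
exists (complex.Re (ip h h)); first by rewrite -lecR -hhE.
move=> mu dmu; have := act_ev_le h dmu; set G := \sum_(p <- mu) _ => hG.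
pose E N := \sum_(p <- mu) \sum_(q <- mu) p.1 * q.1^* * dBR_kernel B p.2 q.2 * (p.2 * q.2^*) ^+ N.
have GE N : G = (\sum_(n < N) (normc (act mu (fun z => z ^+ n)) ^+ 2 -
                      normc (act mu (fun z => B z * z ^+ n)) ^+ 2))%:C + E N.
  rewrite rmorph_sum /=.
  rewrite (eq_bigr (fun n : 'I_N => \sum_(p <- mu) \sum_(q <- mu)
     p.1 * q.1^* * (1 - (B q.2)^* * B p.2) * (p.2 * q.2^*) ^+ n)); last first.
    move=> n _; rewrite rmorphB /= !sqr_normcE !act_conj -sumrB; apply: eq_bigr => p _.
    rewrite -sumrB; apply: eq_bigr => q _.
    by rewrite !rmorphM /= !rmorphXn /= exprMn; ring.
  rewrite exchange_big /= /E -big_split /=; apply: eq_big_seq => p pmu.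
  rewrite exchange_big /= -big_split /=; apply: eq_big_seq => q qmu.
  rewrite -mulr_sumr /dBR_kernel.
  set t := p.2 * q.2^*.
  have t1 : 1 - t != 0.
    rewrite subr_eq0 eq_sym; apply/eqP => /(congr1 (@normc R)); rewrite normc1 /t normcM.
    have -> : normc (conjC q.2) = normc q.2 := normc_conj q.2.
    have := dmu _ pmu; have := dmu _ qmu; have := normc_ge0 p.2; have := normc_ge0 q.2.
    nra.
  have -> : \sum_(i < N) t ^+ i = (1 - t ^+ N) / (1 - t).
    by have := subrX1 t N; move=> h1; apply: (mulfI t1); rewrite mulrCA mulfV// mulr1 -opprB mulNr -h1 opprB.
  rewrite (mulrC (conjC q.2)) -/t; field; exact: t1.
have EN N : normc (E N) <= \sum_(p <- mu) \sum_(q <- mu)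
    normc (p.1 * q.1^* * dBR_kernel B p.2 q.2) * (normc p.2 * normc q.2) ^+ N.
  apply: le_trans (normc_sum _ _ _) _; apply: ler_sum => p _.
  apply: le_trans (normc_sum _ _ _) _; apply: ler_sum => q _.
  rewrite normcM normcX [normc (p.2 * _)]normcM.
  by have -> : normc (conjC q.2) = normc q.2 := normc_conj q.2.
exists (fun N => \sum_(p <- mu) \sum_(q <- mu)
    normc (p.1 * q.1^* * dBR_kernel B p.2 q.2) * (normc p.2 * normc q.2) ^+ N).
  clear -dmu.

  apply: null_sum => p pmu; apply: null_sum => q qmu; apply: null_geo.
  have := dmu _ pmu; have := dmu _ qmu; have := normc_ge0 p.2; have := normc_ge0 q.2.
  move=> h1 h2 h3 h4; rewrite mulr_ge0//=; nra.
move=> N; move: hG; rewrite norm_normc -rmorphXn /= hhE lecE => /andP[_].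
rewrite Re_realM /= => /le_trans; apply; apply: ler_wpM2l; first by rewrite -lecR -hhE.
rewrite (GE N) ReD /= lerD2l.
exact: le_trans (ler_norm _) (le_trans (Re_normc _) (EN N)).
Qed.

(** [X] bounds the square norm of the moments of [mu]. Keeping a single moment of
    [b mu] in the negative part is enough to detect that [b] is inner. *)
Definition evaluation_bound (f : R[i] -> R[i]) (hh : R) :=
  forall mu, in_disc mu ->
  forall X m, (forall N, \sum_(n < N) normc (act mu (fun z => z ^+ n)) ^+ 2 <= X) ->
  normc (act mu f) ^+ 2 <= hh * (X - normc (act mu (fun z => B z * z ^+ m)) ^+ 2).

Lemma rkhs_bound (h : H) : exists2 hh : R, 0 <= hh & evaluation_bound (ev h) hh.
Proof.
have [hh hh0 hb] := rkhs_ineq h; exists hh => // mu dmu X m hX.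
have [e e0 he] := hb _ dmu.
apply: (@le_null _ _ _ (fun N => hh * e (N + m.+1)%N)).
  rewrite -[X in _ --> X](mulr0 hh); apply: cvgMr.
  by rewrite (cvg_shiftn m.+1 e).
move=> N; apply: le_trans (he (N + m.+1)%N) _.
rewrite -mulrDr ler_wpM2l// lerD2r sumrB lerB//.
rewrite (bigD1 (Ordinal (ltn_addl N (ltnSn m))))//= lerDl sumr_ge0// => i _.
exact: sqr_ge0.
Qed.

(** The l2 norm of the moments is at most their l1 norm, which is easier to estimate. *)
Lemma rkhs_bound1 (h : H) : exists2 s : R, 0 <= s & forall mu, in_disc mu ->
  forall Y, (forall N, \sum_(n < N) normc (act mu (fun z => z ^+ n)) <= Y) ->
  normc (act mu (ev h)) <= s * Y.
Proof.
have [hh hh0 hb] := rkhs_bound h; exists (Num.sqrt hh); first exact: sqrtr_ge0.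
move=> mu dmu Y hY.
have Y0 : 0 <= Y by have := hY 0%N; rewrite big_ord0.
rewrite -(@ler_pXn2r _ 2) ?nnegrE ?mulr_ge0 ?sqrtr_ge0 ?normc_ge0//.
rewrite exprMn sqr_sqrtr//.
have hX N : \sum_(n < N) normc (act mu (fun z => z ^+ n)) ^+ 2 <= Y ^+ 2.
  apply: le_trans (@sum_sqr_le R N (fun n => normc (act mu (fun z => z ^+ n))) (fun k => normc_ge0 _)) _.
  by rewrite lerXn2r ?nnegrE// sumr_ge0// => i _; exact: normc_ge0.
apply: le_trans (hb _ dmu _ 0%N hX) _; apply: ler_wpM2l => //.
by rewrite lerBlDr lerDl sqr_ge0.
Qed.

End RKHS.

(** * Reading off Taylor coefficients by sampling *)

Lemma act_cat (R : rcfType) (mu nu : seq (R[i] * R[i])) phi :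
  act (mu ++ nu) phi = act mu phi + act nu phi.
Proof. by rewrite /act big_cat. Qed.

Definition oppm (R : rcfType) (mu : seq (R[i] * R[i])) := [seq (- p.1, p.2) | p <- mu].

Lemma act_oppm (R : rcfType) (mu : seq (R[i] * R[i])) phi :
  act (oppm mu) phi = - act mu phi.
Proof. by rewrite /act big_map -sumrN; apply: eq_bigr => p _; rewrite mulNr. Qed.

Lemma in_disc_cat (R : rcfType) (mu nu : seq (R[i] * R[i])) :
  in_disc mu -> in_disc nu -> in_disc (mu ++ nu).
Proof. by move=> h1 h2 p; rewrite mem_cat => /orP[/h1|/h2]. Qed.

Lemma in_disc_oppm (R : rcfType) (mu : seq (R[i] * R[i])) :
  in_disc mu -> in_disc (oppm mu).
Proof. by move=> h p /mapP[q /h qd ->]. Qed.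

Section Sampling.
Variable R : realType.
Implicit Types (d : nat -> R[i]) (f : R[i] -> R[i]).

Definition half : R[i] := (2^-1 : R)%:C.

Definition root_of (M : nat) : R[i] :=
  if pselect (exists z : R[i], M.-primitive_root z) is left e then projT1 (cid e) else 0.

Lemma root_ofP M : (0 < M)%N -> M.-primitive_root (root_of M).
Proof.
move=> M0; rewrite /root_of; case: pselect => [e|[]]; first exact: projT2 (cid e).
exact: prim_root_exists.
Qed.

(** The combination of evaluations at the points [z_j = w^j / 2], [w] a primitive [M]-th
    root of unity, which is a discrete form of [f |-> sum_(n < D) d_n alpha_n], where the
    coefficient [alpha_n] of [f] is the mean of [f(z_j) / z_j^n]. *)
Definition sampling (M D : nat) d : seq (R[i] * R[i]) :=
  [seq (M%:R^-1 * \sum_(n < D) d n * half ^- n * (root_of M ^+ j)^* ^+ n,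
        half * root_of M ^+ j) | j <- iota 0 M].

Definition sample (M n : nat) f : R[i] :=
  M%:R^-1 * \sum_(j < M) half ^- n * (root_of M ^+ j)^* ^+ n * f (half * root_of M ^+ j).

Lemma normc_half : normc half = 2^-1.
Proof. by rewrite normcR ger0_norm. Qed.

Lemma half_neq0 : half != 0.
Proof. by apply/eqP => /(congr1 (@normc R)); rewrite normc_half normc0 => /eqP; rewrite invr_eq0 pnatr_eq0. Qed.

Lemma in_disc_sampling M D d : (0 < M)%N -> in_disc (sampling M D d).
Proof.
move=> M0 p /mapP[j _ ->] /=.
rewrite normcM normc_half normcX (prim_root_normc (root_ofP M0)) expr1n; lra.
Qed.

Lemma act_sampling M D d f :
  act (sampling M D d) f = \sum_(n < D) d n * sample M n f.
Proof.
rewrite /act /sampling big_map -(big_mkord xpredT (fun n => d n * sample M n f)).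
rewrite /sample -{1}(subn0 M) -/(index_iota 0 M) big_mkord /=.
rewrite big_mkord.
under [in RHS]eq_bigr do rewrite mulrCA mulr_sumr.
rewrite -mulr_sumr exchange_big mulr_sumr /=; apply: eq_bigr => j _.
rewrite -mulrA mulr_suml; congr (_ * _); apply: eq_bigr => n _; ring.
Qed.

Lemma sample_pow M n l : (0 < M)%N ->
  sample M n (fun z => z ^+ l) =
  if (l == n %[mod M])%N then half ^- n * half ^+ l else 0.
Proof.
move=> M0; rewrite /sample.
have -> : \sum_(j < M) half ^- n * (root_of M ^+ j)^* ^+ n * (half * root_of M ^+ j) ^+ l =
  half ^- n * half ^+ l * \sum_(j < M) (root_of M ^+ j) ^+ l * ((root_of M ^+ j)^*) ^+ n.
  by rewrite mulr_sumr; apply: eq_bigr => j _; rewrite exprMn; ring.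
rewrite (sum_prim_root _ _ (root_ofP M0)); case: ifP => _; last by rewrite !mulr0.
by rewrite mulrC mulfK// pnatr_eq0 -lt0n.
Qed.

(** Sampling at [M] points confuses [z^l] with [z^(l %% M)] up to the factor [(1/2)^(l - l %% M)];
    these aliases are the only error. *)
Lemma moment_sampling M D d l : (0 < M)%N -> (D <= M)%N ->
  act (sampling M D d) (fun z => z ^+ l) =
  if (l %% M < D)%N then d (l %% M)%N * (half ^- (l %% M) * half ^+ l) else 0.
Proof.
move=> M0 DM; rewrite act_sampling.
under eq_bigr do rewrite sample_pow//.
case: ltnP => lD.
  rewrite (bigD1 (Ordinal lD))//= modn_mod eqxx big1 ?addr0// => n nl.
  case: ifP => [/eqP ln|]; last by rewrite mulr0.
  case/eqP: nl; apply: val_inj => /=.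
  by rewrite ln modn_small// (leq_trans (ltn_ord n)).
rewrite big1// => n _; case: ifP => [/eqP ln|]; last by rewrite mulr0.
have := ltn_ord n; rewrite ltnNge; case/negP.
by rewrite (leq_trans lD)// ln modn_small// (leq_trans (ltn_ord n)).
Qed.

Lemma moment_sampling_small M D d l : (0 < M)%N -> (D <= M)%N -> (l < M)%N ->
  act (sampling M D d) (fun z => z ^+ l) = if (l < D)%N then d l else 0.
Proof.
move=> M0 DM lM; rewrite moment_sampling// modn_small//; case: ifP => // _.
by rewrite mulVf ?mulr1// expf_neq0 ?half_neq0.
Qed.

Lemma moment_sampling_le M D d l (A : R) : (0 < M)%N -> (D <= M)%N ->
  (forall n, normc (d n) <= A) ->
  normc (act (sampling M D d) (fun z => z ^+ l)) <= A * 2 ^+ D * 2^-1 ^+ l.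
Proof.
move=> M0 DM hA; have A0 : 0 <= A := le_trans (normc_ge0 _) (hA 0%N).
have h2 : 0 <= A * 2 ^+ D * 2^-1 ^+ l by rewrite !mulr_ge0// exprn_ge0.
rewrite moment_sampling//; case: ifP => lD; last by rewrite normc0.
rewrite !normcM normcV !normcX normc_half mulrA ler_wpM2r ?exprn_ge0//.
rewrite ler_pM ?normc_ge0 ?invr_ge0 ?exprn_ge0//.
by rewrite exprVn invrK; apply: ler_weXn2l; [lra | exact: ltnW].
Qed.

Lemma tail_half (C : R) M N (u : nat -> R) : 0 <= C -> (forall l, u l <= C * 2^-1 ^+ l) ->
  \sum_(M <= l < N) u l <= 2 * C * 2^-1 ^+ M.
Proof.
move=> C0 uC; apply: le_trans (ler_sum _ (fun l _ => uC l)) _.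
rewrite -mulr_sumr (mulrC 2) -mulrA ler_wpM2l//.
have := @sum_geo_le R 2^-1 M N; rewrite (_ : (2^-1 : R) ^+ M / (1 - 2^-1) = 2 * 2^-1 ^+ M); last by field.
by apply; lra.
Qed.

End Sampling.

Definition sampled_coefs (R : realType) (f : R[i] -> R[i]) (alpha : nat -> R[i]) :=
  forall n, exists K, forall M, (n < M)%N ->
    normc (alpha n - sample M n f) <= K * 2^-1 ^+ M.

Section Expansion.
Variables (R : realType) (B : R[i] -> R[i]).
Variables (H : completeNormedModType R[i]) (ip : {dot H for conjC}).
Variables (ev : H -> R[i] -> R[i]).
Hypothesis rk : is_RKHS (dBR_kernel B) ip ev.
Variable h : H.

(** Two samplings with [M] and [M' >= M] points have the same moments below [M], and the
    remaining moments are aliases of size [(1/2)^M]. *)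
Lemma sample_cauchy : exists2 s : R, 0 <= s & forall n M M', (n < M)%N -> (M <= M')%N ->
  normc (sample M' n (ev h) - sample M n (ev h)) <= s * 4 * 2 ^+ n.+1 * 2^-1 ^+ M.
Proof.
have [s s0 hs] := rkhs_bound1 rk h; exists s => // n M M' nM MM'.
have M0 : (0 < M)%N by apply: leq_ltn_trans nM.
have M'0 : (0 < M')%N by apply: leq_trans MM'.
have nM' : (n < M')%N by apply: leq_trans MM'.
pose d (k : nat) : R[i] := (k == n)%:R.
have sd m : act (sampling m n.+1 d) (ev h) = sample m n (ev h).
  rewrite act_sampling (bigD1 ord_max)//= big1 ?addr0 => [|i ni].
    by rewrite /d eqxx mul1r.
  by rewrite /d -[_ == _]/(i == ord_max) (negbTE ni) mul0r.
have d1 k : normc (d k) <= 1.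
  by rewrite /d; case: (k == n); rewrite ?normc1 ?normc0.
pose mu := sampling M' n.+1 d ++ oppm (sampling M n.+1 d).
have dmu : in_disc mu.
  by apply: in_disc_cat; [|apply: in_disc_oppm]; exact: in_disc_sampling.
have -> : sample M' n (ev h) - sample M n (ev h) = act mu (ev h).
  by rewrite act_cat act_oppm !sd.
rewrite -!mulrA; apply: hs => // N.
apply: le_trans (@sum_ord_split R (fun l => normc (act mu (fun z => z ^+ l))) M N
  (fun l => normc_ge0 _)) _.
rewrite big1 ?add0r => [|l _]; last first.
  rewrite act_cat act_oppm !moment_sampling_small// ?subrr ?normc0//.
  by apply: leq_trans MM'.
have := @tail_half R (2 * 2 ^+ n.+1) M N (fun l => normc (act mu (fun z => z ^+ l))).
rewrite !mulrA -natrM; apply; first by rewrite mulr_ge0 ?exprn_ge0.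
move=> l; rewrite act_cat act_oppm; apply: le_trans (normcB _ _) _.
rewrite mulr2n !mulrDl; apply: lerD; exact: moment_sampling_le.
Qed.

(** The power series comes from the boundedness of evaluations: the difference
    between the evaluation at [z] and the sampling of [sum_(n < D) z^n alpha_n] has
    vanishing moments below [D]. *)
Lemma expansion : exists2 alpha : nat -> R[i],
  has_power_series 1 alpha (ev h) & sampled_coefs (ev h) alpha.
Proof.
have [s s0 hs] := sample_cauchy.
have /choice[alpha ha] : forall n, exists a, forall M,
    normc (a - sample (M + n.+1) n (ev h)) <= 2 * (s * 4 * 2 ^+ n.+1 * 2^-1 ^+ (M + n.+1)).
  move=> n; apply: (dominated_cauchyC (u := fun M => sample (M + n.+1) n (ev h))
     (e := fun M => s * 4 * 2 ^+ n.+1 * 2^-1 ^+ (M + n.+1))) => M M' MM'.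
  by apply: hs; rewrite ?leq_add2r// leq_addl.
have ha' n M : (n < M)%N -> normc (alpha n - sample M n (ev h)) <= 8 * s * 2 ^+ n.+1 * 2^-1 ^+ M.
  move=> nM; have := ha n (M - n.+1)%N; rewrite subnK//.
  by move=> hh; apply: le_trans hh _; rewrite (_ : 8 = 2 * 4 :> R) -?natrM//; lra.
have [s' s'0 hs'] := rkhs_bound1 rk h.
exists alpha; last by move=> n; exists (8 * s * 2 ^+ n.+1); exact: ha'.
have dist z D : normc z < 1 ->
    normc (ev h z - \sum_(n < D) alpha n * z ^+ n) <= s' / (1 - normc z) * normc z ^+ D.
  move=> z1; have z0 := normc_ge0 z.
  have nz : 0 < 1 - normc z by lra.
  pose K := s' * (2 * 2 ^+ D) + \sum_(n < D) 8 * s * 2 ^+ n.+1.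
  apply: (@le_null _ _ _ (fun M => K * 2^-1 ^+ (M + D.+1))).
    rewrite (cvg_shiftn D.+1 (fun M => K * 2^-1 ^+ M)); apply: null_geo; lra.
  move=> M'; set M := (M' + D.+1)%N.
  have DM : (D < M)%N by rewrite /M leq_addl.
  have M0 : (0 < M)%N by apply: leq_ltn_trans DM.
  pose d n := z ^+ n.
  pose mu := (1, z) :: oppm (sampling M D d).
  have dmu : in_disc mu.
    move=> p; rewrite inE => /orP[/eqP->//|]; apply: in_disc_oppm.
    exact: in_disc_sampling.
  have actmu phi : act mu phi = phi z - \sum_(n < D) d n * sample M n phi.
    by rewrite /act big_cons mul1r -/(act _ _) act_oppm act_sampling.
  have -> : ev h z - \sum_(n < D) alpha n * z ^+ n =
     act mu (ev h) + \sum_(n < D) d n * (sample M n (ev h) - alpha n).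
    rewrite actmu -!addrA; congr (_ + _).
    by rewrite -!sumrN -big_split /=; apply: eq_bigr => n _; rewrite /d; ring.
  apply: le_trans (normcD _ _) _.
  rewrite /K mulrDl addrA; apply: lerD; last first.
    apply: le_trans (normc_sum _ _ _) _; rewrite mulr_suml; apply: ler_sum => n _.
    rewrite normcM /d normcX -[leRHS]mul1r normcBC ler_pM ?exprn_ge0 ?normc_ge0//.
      by rewrite exprn_ile1// ltW.
    by apply: ha'; apply: ltn_trans DM.
  have -> : s' / (1 - normc z) * normc z ^+ D + s' * (2 * 2 ^+ D) * 2^-1 ^+ M =
     s' * (normc z ^+ D / (1 - normc z) + 2 * (1 * 2 ^+ D) * 2^-1 ^+ M) by ring.
  apply: hs' => // N.
  pose x l := normc (act mu (fun w => w ^+ l)).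
  pose y l := normc (act (sampling M D d) (fun w => w ^+ l)).
  have xl l : (D <= l)%N -> x l <= normc z ^+ l + y l.
    move=> Dl; rewrite /x /y actmu -act_sampling -normcX; exact: normcB.
  have x0 l : (l < D)%N -> x l = 0.
    move=> lD; rewrite /x actmu -act_sampling moment_sampling_small ?lD ?subrr ?normc0//.
      exact: ltnW. by apply: ltn_trans DM.
  apply: le_trans (@sum_ord_split _ x D N (fun l => normc_ge0 _)) _.
  rewrite big1 ?add0r => [|l _]; last exact: x0.
  apply: (@le_trans _ _ (\sum_(D <= l < N) (normc z ^+ l + y l))).
    by rewrite !big_nat; apply: ler_sum => l /andP[Dl _]; exact: xl.
  rewrite big_split /=; apply: lerD; first by apply: sum_geo_le; rewrite z0.
  apply: (@le_trans _ _ (\sum_(M <= l < N) y l)); last first.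
    apply: (@tail_half R (1 * 2 ^+ D) M N y); first by rewrite mul1r exprn_ge0.
    move=> l; apply: moment_sampling_le => //; first exact: ltnW.
    by move=> n; rewrite /d normcX exprn_ile1// ltW.
  have yz l : (D <= l < M)%N -> y l = 0.
    move=> /andP[Dl lM]; rewrite /y moment_sampling_small ?(ltnW DM)//.
    by rewrite ltnNge Dl normc0.
  have [NM|MN] := leqP N M.
    rewrite [leRHS]big_geq// big_nat big1// => l /andP[Dl lN]; apply: yz.
    by rewrite Dl (leq_trans lN).
  rewrite (@big_cat_nat _ _ _ M D N) ?(ltnW DM) ?(ltnW MN)//=.
  by rewrite big_nat big1 ?add0r// => l; exact: yz.
split; last first.
  move=> z z1; exists (s' / (1 - normc z)), (normc z); split=> [|n].
    by rewrite normc_ge0 z1.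
  exact: dist.
(* Sampling at [n + 1] points already bounds [alpha n], uniformly in [n]. *)
have bnd n : normc (alpha n) <= 8 * s + 3 * s'.
  have M0 : (0 < n.+1)%N by [].
  pose d (k : nat) : R[i] := (k == n)%:R.
  have sd : act (sampling n.+1 n.+1 d) (ev h) = sample n.+1 n (ev h).
    rewrite act_sampling (bigD1 ord_max)//= big1 ?addr0 => [|i ni].
      by rewrite /d eqxx mul1r.
    by rewrite /d -[_ == _]/(i == ord_max) (negbTE ni) mul0r.
  have d1 k : normc (d k) <= 1.
    by rewrite /d; case: (k == n); rewrite ?normc1 ?normc0.
  have -> : alpha n = (alpha n - sample n.+1 n (ev h)) + sample n.+1 n (ev h) by rewrite subrK.
  have two : (2 : R) ^+ n.+1 * 2^-1 ^+ n.+1 = 1 by rewrite -exprMn divff ?expr1n.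
  apply: le_trans (normcD _ _) _; apply: lerD.
    by apply: le_trans (ha' _ _ (ltnSn n)) _; rewrite -mulrA two mulr1.
  rewrite -sd mulrC; apply: hs'; first exact: in_disc_sampling.
  move=> N; apply: le_trans (@sum_ord_split R (fun l => normc (act (sampling n.+1 n.+1 d)
    (fun z => z ^+ l))) n.+1 N (fun l => normc_ge0 _)) _.
  rewrite (_ : 3 = 1 + 2 * (1 * 2 ^+ n.+1) * 2^-1 ^+ n.+1); last by rewrite mul1r -mulrA two; ring.
  apply: lerD; last first.
    apply: (@tail_half R (1 * 2 ^+ n.+1) n.+1 N
      (fun l => normc (act (sampling n.+1 n.+1 d) (fun w => w ^+ l)))).
      by rewrite mul1r exprn_ge0.
    by move=> l; apply: moment_sampling_le.
  rewrite big_ord_recr /= big1 ?add0r => [|l _]; last first.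
    rewrite moment_sampling_small// ?(ltn_trans (ltn_ord l))// /d.
    by rewrite (ltn_eqF (ltn_ord l)) normc0.
  by rewrite moment_sampling_small// ltnSn.
move=> r /andP[r0 r1]; exists (8 * s + 3 * s') => n.
apply: le_trans (bnd n); rewrite -[leRHS]mulr1 ler_wpM2l ?normc_ge0//.
by rewrite exprn_ile1// ltW.
Qed.

(** [rkhs_bound] is applied to the sampling of [d]. As [M] grows its moments tend to [d],
    and the [m]-th moment of its product with [B] tends to
    [sum_k beta_k d_(k + m)]. *)
Lemma coef_pairing (beta alpha : nat -> R[i]) (d : nat -> R[i]) (D m : nat) (hh A : R) :
  0 <= hh -> evaluation_bound B (ev h) hh -> sampled_coefs (ev h) alpha ->
  has_power_series 1 beta B -> (forall n, normc (beta n) <= 1) -> (forall n, normc (d n) <= A) ->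
  (m <= D)%N ->
  normc (\sum_(n < D) d n * alpha n) ^+ 2 <=
  hh * (\sum_(n < D) normc (d n) ^+ 2 - normc (\sum_(k < D - m) beta k * d (k + m)%N) ^+ 2).
Proof.
move=> hh0 hb ha [_ pB] b1 dA mD; set Y0 := \sum_(k < D - m) _.
have A0 : 0 <= A := le_trans (normc_ge0 _) (dA 0%N).
pose T M : R := 2 * (A * 2 ^+ D) * 2^-1 ^+ M.
have T0 M : 0 <= T M by rewrite /T !mulr_ge0 ?exprn_ge0.
have Tnull : T M @[M --> \oo] --> (0 : R) by apply: null_geo; lra.
have mom2 M N : (D < M)%N ->
    \sum_(n < N) normc (act (sampling M D d) (fun z => z ^+ n)) ^+ 2 <=
    \sum_(n < D) normc (d n) ^+ 2 + T M ^+ 2.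
  move=> DM; have M0 : (0 < M)%N by apply: leq_ltn_trans DM.
  apply: le_trans (@sum_ord_split R (fun l => normc (act (sampling M D d)
    (fun z => z ^+ l)) ^+ 2) M N (fun l => sqr_ge0 _)) _.
  apply: lerD.
    rewrite -(big_mkord xpredT (fun l => normc (act (sampling M D d) (fun z => z ^+ l)) ^+ 2)).
    rewrite (@big_cat_nat _ _ _ D 0 M) ?(ltnW DM)//= [X in _ + X <= _]big_nat [X in _ + X]big1.
      rewrite addr0 big_mkord; apply: ler_sum => l _.
      by rewrite moment_sampling_small ?(ltnW DM) ?ltn_ord// (ltn_trans (ltn_ord l)).
    move=> l /andP[Dl lM]; rewrite moment_sampling_small ?(ltnW DM)//.
    by rewrite ltnNge Dl normc0 expr0n.
  pose u l := normc (act (sampling M D d) (fun z => z ^+ (l + M))).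
  have [NM|/ltnW MN] := leqP N M; first by rewrite big_geq// sqr_ge0.
  rewrite -{1}(add0n M) big_addn big_mkord.
  apply: le_trans (@sum_sqr_le R (N - M)%N u (fun l => normc_ge0 _)) _.
  rewrite lerXn2r ?nnegrE ?sumr_ge0// => [i _|]; first exact: normc_ge0.
  rewrite -(big_mkord xpredT u) -(big_addn 0 N M xpredT
    (fun l => normc (act (sampling M D d) (fun z => z ^+ l)))) add0n.
  apply: (@tail_half R _ M N); first by rewrite mulr_ge0 ?exprn_ge0.
  by move=> l; apply: moment_sampling_le => //; exact: ltnW.
have actB M : (D < M)%N ->
    normc (Y0 - act (sampling M D d) (fun z => B z * z ^+ m)) <= T M.
  move=> DM; have M0 : (0 < M)%N by apply: leq_ltn_trans DM.
  set mu := sampling M D d; have dmu : in_disc mu by exact: in_disc_sampling.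
  have /choice[e he] : forall z, exists e : nat -> R, normc z < 1 ->
     e n @[n --> \oo] --> (0 : R) /\
     forall n, normc (B z - \sum_(k < n) beta k * z ^+ k) <= e n.
    move=> z; have [z1|z1] := boolP (normc z < 1); last by exists (fun=> 0).
    by have [e e0 he] := sums_toP (pB _ z1); exists e.
  pose E n := \sum_(p <- mu) normc (p.1 * p.2 ^+ m) * e p.2 n.
  have E0 : E n @[n --> \oo] --> (0 : R).
    apply: null_sum => p pmu; rewrite -[X in _ --> X](mulr0 (normc (p.1 * p.2 ^+ m))).
    by apply: cvgMr; have [] := he _ (dmu _ pmu).
  apply: (le_null (e := fun n => E (n + M)%N)); first by rewrite (cvg_shiftn M E).
  move=> n; set L := (n + M)%N.
  pose S := \sum_(k < L) beta k * act mu (fun z => z ^+ (k + m)).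
  have SE : act mu (fun z => (\sum_(k < L) beta k * z ^+ k) * z ^+ m) = S.
    rewrite /act /S; under [RHS]eq_bigr do rewrite mulr_sumr.
    rewrite exchange_big /=; apply: eq_bigr => p _.
    rewrite mulr_suml mulr_sumr; apply: eq_bigr => k _; rewrite exprD; ring.
  have -> : Y0 - act mu (fun z => B z * z ^+ m) =
     (Y0 - S) - act mu (fun z => (B z - \sum_(k < L) beta k * z ^+ k) * z ^+ m).
    rewrite -SE /act -!addrA; congr (_ + _); rewrite -!sumrN -big_split /=.
    by apply: eq_bigr => p _; ring.
  apply: le_trans (normcB _ _) _; apply: lerD; last first.
    apply: le_trans (normc_sum _ _ _) _; rewrite /E !big_seq; apply: ler_sum => p pmu.
    rewrite mulrCA normcM mulrC ler_wpM2l ?normc_ge0//.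
    by have [_ ->] := he _ (dmu _ pmu).
  have DL : (D - m <= L)%N by rewrite (leq_trans (leq_subr _ _))// (leq_trans (ltnW DM))// leq_addl.
  pose v l := normc (act mu (fun z => z ^+ l)).
  have vD l : (D <= l < M)%N -> v l = 0.
    move=> /andP[Dl lM]; rewrite /v moment_sampling_small ?(ltnW DM)//.
    by rewrite ltnNge Dl normc0.
  have -> : Y0 - S = - \sum_(D - m <= k < L) beta k * act mu (fun z => z ^+ (k + m)).
    rewrite /S -(big_mkord xpredT (fun k => beta k * act mu (fun z => z ^+ (k + m)))).
    rewrite (@big_cat_nat _ _ _ (D - m) 0 L)//= big_mkord opprD addrA.
    rewrite /Y0 -sumrB big1 ?sub0r// => k _.
    have kD : (k + m < D)%N by have := ltn_ord k; lia.
    by rewrite moment_sampling_small ?kD ?subrr ?(ltnW DM)// (ltn_trans kD).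
  have := @normcN R; move=> ->; apply: le_trans (normc_sum _ _ _) _.
  apply: (@le_trans _ _ (\sum_(D - m <= k < L) v (k + m)%N)).
    apply: ler_sum => k _; rewrite normcM -[leRHS]mul1r ler_wpM2r ?normc_ge0//.
  have := big_addn (D - m) (L + m) m xpredT v; rewrite subnK// addnK => <-.
  have ML : (M <= L + m)%N by rewrite /L; lia.
  rewrite (@big_cat_nat _ _ _ M D (L + m))//=; last exact: ltnW.
  rewrite big_nat big1 ?add0r => [|l]; last exact: vD.
  apply: (@tail_half R (A * 2 ^+ D)); first by rewrite mulr_ge0 ?exprn_ge0.
  by move=> l; apply: moment_sampling_le => //; exact: ltnW.
have /choice[K hK] := ha.
pose P N := act (sampling (N + D.+1) D d) (ev h).
have PE : normc (\sum_(n < D) d n * alpha n - P N) @[N --> \oo] --> (0 : R).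
  apply: (@squeeze_cvgr _ _ _ _ (fun=> 0)
    (fun N => (\sum_(n < D) A * K n) * 2^-1 ^+ (N + D.+1))).
  - apply: nearW => N; rewrite normc_ge0 /= /P act_sampling -sumrB mulr_suml.
    apply: le_trans (normc_sum _ _ _) _; apply: ler_sum => n _.
    rewrite -mulrBr normcM -mulrA ler_pM ?normc_ge0//; apply: hK.
    by have := ltn_ord n; lia.
  - exact: cvg_cst.
  - rewrite (cvg_shiftn D.+1 (fun N => (\sum_(n < D) A * K n) * 2^-1 ^+ N)).
    by apply: null_geo; lra.
apply: (@limr_le_null _ _ _ _ (fun N => hh * (T (N + D.+1)%N ^+ 2 + 2 * normc Y0 * T (N + D.+1)%N))
  (cvg_normc_sqr PE)).
  have Tn : T (N + D.+1)%N @[N --> \oo] --> (0 : R) by rewrite (cvg_shiftn D.+1 T).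
  rewrite -[X in _ --> X](mulr0 hh); apply: cvgMr; apply: null_add.
    by rewrite -[X in _ --> X](expr0n R 2); under eq_fun do rewrite expr2; apply: cvgM.
  by rewrite -[X in _ --> X](mulr0 (2 * normc Y0)); apply: cvgMr.
move=> N; set M := (N + D.+1)%N; have DM : (D < M)%N by rewrite /M; lia.
have M0 : (0 < M)%N by apply: leq_ltn_trans DM.
have hbM := hb _ (@in_disc_sampling R M D d M0) _ m (fun n => mom2 M n DM).
apply: le_trans hbM _.
rewrite -mulrDr; apply: ler_wpM2l => //.
have := actB M DM; have := T0 M.
set y := act _ _ => t0 hy.
have yY : normc Y0 <= T M + normc y.
  by rewrite -(subrK y Y0); apply: le_trans (normcD _ _) _; rewrite lerD2r.
have y0 := normc_ge0 y; have Y00 := normc_ge0 Y0.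
have : normc Y0 ^+ 2 - 2 * normc Y0 * T M <= normc y ^+ 2.
  have [hT|hT] := lerP (normc Y0) (T M); nra.
lra.
Qed.

(** With [d] the conjugate of the truncated shift of [beta], both the squared norm of [d]
    and its pairing with [beta] are the partial sum [S]. The bound [S - S^2] vanishes in
    the limit precisely when [S] tends to 1, that is for inner [B]. *)
Lemma shifted_pairing (beta : nat -> R[i]) :
  has_power_series 1 beta B -> (forall n, normc (beta n) <= 1) ->
  exists2 alpha : nat -> R[i], has_power_series 1 alpha (ev h) &
  exists2 hh : R, 0 <= hh & forall N m,
  normc (\sum_(n < N) (beta n)^* * alpha (n + m)%N) ^+ 2 <=
  hh * (\sum_(n < N) normc (beta n) ^+ 2 - (\sum_(n < N) normc (beta n) ^+ 2) ^+ 2).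
Proof.
move=> pB b1; have [alpha pa ha] := expansion.
have [hh hh0 hb] := rkhs_bound rk h.
exists alpha; first exact: pa.
exists hh; first exact: hh0.
move=> N m; set S := \sum_(n < N) normc (beta n) ^+ 2.
pose d k := if (k < m)%N then 0 else (beta (k - m)%N)^*.
have d1 k : normc (d k) <= 1.
  rewrite /d; case: ifP => _; first by rewrite normc0.
  by have -> : normc (conjC (beta (k - m)%N)) = normc (beta (k - m)%N) := normc_conj _.
have dS k : d (k + m)%N = (beta k)^* by rewrite /d ltnNge leq_addl addnK.
have shift (V : nmodType) (F : nat -> V) : (forall k, (k < m)%N -> F k = 0) ->
    \sum_(k < N + m) F k = \sum_(k < N) F (k + m)%N.
  move=> F0; rewrite -(big_mkord xpredT F) (@big_cat_nat _ _ _ m 0)//= ?leq_addl//.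
  rewrite big_nat big1 ?add0r => [|k]; last exact: F0.
  by rewrite -{1}(add0n m) big_addn addnK big_mkord.
have := @coef_pairing beta alpha d (N + m) m hh 1 hh0 hb ha pB b1 d1 (leq_addl _ _).
rewrite addnK (shift _ (fun k => normc (d k) ^+ 2)); last first.
  by move=> k km; rewrite /d km normc0 expr0n.
rewrite (shift _ (fun k => d k * alpha k)); last by move=> k km; rewrite /d km mul0r.
under eq_bigr do rewrite dS; move=> hP; apply: le_trans hP _; apply: ler_wpM2l => //.
under eq_bigr do rewrite dS.
have -> : \sum_(i < N) normc (conjC (beta i)) ^+ 2 = S.
  by apply: eq_bigr => i _; have -> : normc (conjC (beta i)) = normc (beta i) := normc_conj _.
under eq_bigr do rewrite dS -sqr_normcE.
have -> : \sum_(i < N) (normc (beta i) ^+ 2)%:C = S%:C by rewrite rmorph_sum.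
by rewrite normcR real_normK ?num_real.
Qed.

End Expansion.

(** * Cyclicity forces the coefficients to vanish *)

Definition conv (R : nzRingType) (p : {poly R}) (b : nat -> R) (n : nat) : R :=
  \sum_(j < n.+1) p`_j * b (n - j)%N.

(** Pairing [alpha] with [b p] is a finite combination of the pairings of [alpha] with the
    shifts of [b]. *)
Lemma conv_pairing (R : realType) (p : {poly R}) (b : nat -> R) (alpha : nat -> R[i]) m N :
  \sum_(n < N) (conv p b n)%:C * alpha (n + m)%N =
  \sum_(j < size p) (p`_j)%:C * \sum_(i < N - j) (b i)%:C * alpha (i + (j + m))%N.
Proof.
elim: N => [|N IH].
  by rewrite big_ord0 big1// => j _; rewrite sub0n big_ord0 mulr0.
rewrite big_ord_recr /= IH.
have -> : (conv p b N)%:C = \sum_(j < size p | (j <= N)%N) (p`_j)%:C * (b (N - j)%N)%:C.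
  rewrite /conv rmorph_sum /= (big_ord_widen (maxn N.+1 (size p))
    (fun j => (p`_j * b (N - j)%N)%:C)) ?leq_maxl//.
  rewrite [RHS](big_ord_widen_cond (maxn N.+1 (size p)) (fun j => (j <= N)%N)
    (fun j => (p`_j)%:C * (b (N - j)%N)%:C)) ?leq_maxr//.
  rewrite [RHS]big_mkcondr; apply: eq_bigr => j _.
  by case: ltnP => [_|jp]; rewrite rmorphM//= nth_default// mul0r.
rewrite mulr_suml [X in _ + X = _]big_mkcond -big_split /=; apply: eq_bigr => j _.
case: leqP => jN; last first.
  by rewrite addr0 (eqP (_ : N.+1 - j == 0)%N)// (eqP (_ : N - j == 0)%N)//; lia.
rewrite subSn// big_ord_recr /= mulrDr mulrA; congr (_ + _ * alpha _).
by rewrite addnA subnK.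
Qed.

(** In [sum_n (b p)_n alpha_(n+m) = 0] the term [n = 0] is [alpha_m], and the other ones
    are dominated by [sum_(n >= 1) |(b p)_n| w_n]. *)
Lemma vanishing_of_cyclic (R : realType) (w : nat -> R) (b : nat -> R) (alpha : nat -> R[i]) :
  (forall n, w n.+1 <= w n) ->
  (forall n, normc (alpha n) <= w n) ->
  (forall m, normc (\sum_(n < N) (b n)%:C * alpha (n + m)%N) @[N --> \oo] --> (0 : R)) ->
  (forall eps, 0 < eps -> exists p : {poly R}, conv p b 0 = 1 /\
     forall N, \sum_(1 <= n < N) `|conv p b n| * w n <= eps) ->
  forall m, alpha m = 0.
Proof.
move=> wd aw orth cyc m; apply: (@eq0_normc R).
apply/eqP; rewrite eq_le normc_ge0 andbT; apply/ler_addgt0Pl => eps eps0; rewrite addr0.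
have [p [p0 hp]] := cyc _ eps0.
pose e N := \sum_(j < size p) `|p`_j| * normc (\sum_(i < N - j) (b i)%:C * alpha (i + (j + m))%N).
have e0 : e N @[N --> \oo] --> (0 : R).
  apply: null_sum => j _; rewrite -[X in _ --> X](mulr0 `|p`_j|); apply: cvgMr.
  have := orth (j + m)%N.
  rewrite -(cvg_shiftn j (fun N => normc (\sum_(i < N - j) (b i)%:C * alpha (i + (j + m))%N))).
  by move=> h0; apply: (cvg_trans _ h0); apply: near_eq_cvg; apply: nearW => n /=; rewrite addnK.
apply: (le_null (null_shift e0)) => N.
have wmono k : w (k + m)%N <= w k.
  by elim: m {orth e e0} => [|m IH]; rewrite ?addn0// addnS; apply: le_trans (wd _) IH.
have := conv_pairing p b alpha m N.+1.
rewrite big_ord_recl p0 mul1r add0n => E.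
have -> : alpha m = \sum_(j < size p) (p`_j)%:C * \sum_(i < N.+1 - j) (b i)%:C * alpha (i + (j + m))%N
   - \sum_(i < N) (conv p b i.+1)%:C * alpha (i.+1 + m)%N.
  by rewrite -E; exact/esym/addrK.
apply: le_trans (normcB _ _) _; rewrite addrC; apply: lerD; last first.
  apply: le_trans (normc_sum _ _ _) _; apply: ler_sum => j _.
  by rewrite normcM normcR.
apply: le_trans (hp N.+1); rewrite big_add1 big_mkord.
apply: le_trans (normc_sum _ _ _) _; apply: ler_sum => j _.
rewrite normcM normcR ler_wpM2l//; exact: le_trans (aw _) (wmono _).
Qed.

Lemma convD (R : nzRingType) (p q : {poly R}) b n : conv (p + q) b n = conv p b n + conv q b n.
Proof. by rewrite /conv -big_split /=; apply: eq_bigr => j _; rewrite coefD mulrDl. Qed.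

(** The coefficients [b] are real, so the conjugations of [shifted_pairing] disappear, and
    its right side [S - S^2] tends to 0. *)
Lemma dBR_uniqueness (R : realType) (w : nat -> R) (b : nat -> R) :
  (forall n, w n.+1 <= w n) ->
  (forall n, `|b n| <= 1) ->
  (forall z s, normc z < 1 -> sums_to (fun n => (b n)%:C) z s -> normc s < 1) ->
  (\sum_(n < N) b n ^+ 2 @[N --> \oo] --> (1 : R)) ->
  (forall eps, 0 < eps -> exists p : {poly R}, conv p b 0 = 1 /\
     forall N, \sum_(1 <= n < N) `|conv p b n| * w n <= eps) ->
  exists b : R[i] -> R[i],
    [/\ holomorphic_on_disc b,
        (forall z, unit_disc z -> unit_disc (b z)) &
        forall f : R[i] -> R[i], in_dBR b f ->
          (forall n, `|taylor_coef f n| <= (w n)%:C) ->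
          forall z, unit_disc z -> f z = 0].
Proof.
move=> wd b1 bdisc bnorm cyc.
have rb : radius_ge 1 (fun n => (b n)%:C : R[i]).
  move=> r /andP[r0 r1]; exists 1 => n; rewrite normcR -[leRHS]mul1r.
  by rewrite ler_pM ?exprn_ge0 ?(ltW r0)// exprn_ile1// ltW.
have [B pB] := power_series_exists rb.
have discE (z : R[i]) : unit_disc z <-> normc z < 1 by rewrite /unit_disc /= norm_normc ltcR.
exists B; split.
- by move=> z /discE; exact: power_series_derivable pB.
- by move=> z /discE z1; apply/discE; apply: bdisc (pB.2 _ z1).
move=> f [H [ip [ev [rk [h fh]]]]] fw z zd.
have [|alpha pa [hh hh0 hS]] := shifted_pairing rk h pB.
  by move=> n; rewrite normcR.
have pf : has_power_series 1 alpha f.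
  split; first exact: pa.1.
  by move=> u u1; rewrite fh; [exact: pa.2 | exact/discE].
have aw n : normc (alpha n) <= w n.
  by rewrite -norm_le_real -(taylor_coef_power_series n ltr01 pf).
have orth m : normc (\sum_(n < N) (b n)%:C * alpha (n + m)%N) @[N --> \oo] --> (0 : R).
  pose S N : R := \sum_(n < N) b n ^+ 2.
  have SN : hh * (S N - S N ^+ 2) @[N --> \oo] --> (0 : R).
    have -> : 0 = hh * (1 - 1 ^+ 2) :> R by rewrite expr1n subrr mulr0.
    apply: cvgMr; apply: cvgB => //; under eq_fun do rewrite expr2.
    by rewrite expr2; apply: cvgM.
  pose u N := normc (\sum_(n < N) (b n)%:C * alpha (n + m)%N).
  have u2 N : u N ^+ 2 <= hh * (S N - S N ^+ 2).
    have -> : S N = \sum_(n < N) normc ((b n)%:C : R[i]) ^+ 2.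
      by apply: eq_bigr => n _; rewrite normcR real_normK ?num_real.
    apply: le_trans (hS N m); rewrite /u.
    suff -> : \sum_(n < N) (b n)%:C * alpha (n + m)%N =
       \sum_(n < N) conjC ((b n)%:C) * alpha (n + m)%N by [].
    by apply: eq_bigr => n _; congr (_ * _); exact/esym/conjc_real.
  have : Num.sqrt (u N ^+ 2) @[N --> \oo] --> Num.sqrt (0 : R).
    apply: continuous_cvg; first exact: sqrt_continuous.
    apply: (@squeeze_cvgr _ _ _ _ (fun=> 0) (fun N => hh * (S N - S N ^+ 2))) => //.
      by apply: nearW => N; rewrite sqr_ge0 u2.
    exact: cvg_cst.
  by rewrite sqrtr0; under eq_fun do rewrite sqrtr_sqr ger0_norm ?normc_ge0//.
have a0 := vanishing_of_cyclic wd aw orth cyc.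
have [e e0 he] := sums_toP (pf.2 z ((discE z).1 zd)).
apply: (@eq0_normc R); apply/eqP; rewrite eq_le normc_ge0 andbT.
apply: (le_null e0) => n; rewrite add0r; apply: le_trans (he n).
by rewrite big1 ?subr0// => k _; rewrite a0 mul0r.
Qed.

(** * The norm of absolutely summable coefficients *)

Definition l1 (R : numDomainType) (p : {poly R}) : R := \sum_(i < size p) `|p`_i|.

Lemma l1E (R : numDomainType) (p : {poly R}) N : (size p <= N)%N ->
  l1 p = \sum_(i < N) `|p`_i|.
Proof.
move=> pN; rewrite /l1 (big_ord_widen N (fun i => `|p`_i|))// big_mkcond.
apply: eq_bigr => i _; case: ltnP => // ip.
by rewrite nth_default// normr0.
Qed.

Lemma l1_ge0 (R : numDomainType) (p : {poly R}) : 0 <= l1 p.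
Proof. exact: sumr_ge0. Qed.

Lemma l1_partial (R : numDomainType) (p : {poly R}) N : \sum_(i < N) `|p`_i| <= l1 p.
Proof.
rewrite (@l1E _ p (maxn N (size p))) ?leq_maxr//.
rewrite (big_ord_widen (maxn N (size p)) (fun i => `|p`_i|)) ?leq_maxl//.
by rewrite big_mkcond; apply: ler_sum => i _; case: ifP.
Qed.

Lemma l1D (R : numDomainType) (p q : {poly R}) : l1 (p + q) <= l1 p + l1 q.
Proof.
pose N := maxn (size p) (size q).
rewrite (@l1E _ (p + q) N) ?size_polyD// (@l1E _ p N) ?leq_maxl//.
rewrite (@l1E _ q N) ?leq_maxr// -big_split /=; apply: ler_sum => i _.
by rewrite coefD ler_normD.
Qed.

Lemma l1N (R : numDomainType) (p : {poly R}) : l1 (- p) = l1 p.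
Proof. by rewrite /l1 size_polyN; apply: eq_bigr => i _; rewrite coefN normrN. Qed.

Lemma l1_0 (R : numDomainType) : l1 (0 : {poly R}) = 0.
Proof. by rewrite /l1 size_poly0 big_ord0. Qed.

Lemma l1_sum (R : numDomainType) (I : Type) (r : seq I) (P : pred I) (F : I -> {poly R}) :
  l1 (\sum_(i <- r | P i) F i) <= \sum_(i <- r | P i) l1 (F i).
Proof.
elim/big_ind2 : _ => [|x a y b xa yb|//]; first by rewrite l1_0.
by rewrite (le_trans (l1D _ _))// lerD.
Qed.

Lemma l1Z (R : numDomainType) (c : R) (p : {poly R}) : l1 (c *: p) = `|c| * l1 p.
Proof.
rewrite (@l1E _ _ (size p)) ?size_scale_leq// /l1 mulr_sumr.
by apply: eq_bigr => i _; rewrite coefZ normrM.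
Qed.

Lemma l1MXn (R : numDomainType) (p : {poly R}) k : l1 ('X^k * p) = l1 p.
Proof.
rewrite (@l1E _ _ (k + size p)); last first.
  by apply: leq_trans (size_polyMleq _ _) _; rewrite size_polyXn.
rewrite big_split_ord /= big1 ?add0r => [|i _]; last first.
  by rewrite coefXnM ltn_ord normr0.
by apply: eq_bigr => i _; rewrite coefXnM ltnNge leq_addr /= addKn.
Qed.

Lemma l1M (R : numDomainType) (p q : {poly R}) : l1 (p * q) <= l1 p * l1 q.
Proof.
rewrite -{1}(coefK p) poly_def mulr_suml; apply: le_trans (l1_sum _ _ _) _.
rewrite [in leRHS]/l1 mulr_suml; apply: ler_sum => i _.
by rewrite -scalerAl l1Z l1MXn.
Qed.

Lemma l1_1 (R : numDomainType) : l1 (1 : {poly R}) = 1.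
Proof. by rewrite /l1 size_poly1 big_ord1 coefC normr1. Qed.

Lemma l1X (R : numDomainType) (p : {poly R}) k : l1 (p ^+ k) <= l1 p ^+ k.
Proof.
elim: k => [|k IH]; first by rewrite !expr0 l1_1.
by rewrite !exprS (le_trans (l1M _ _))// ler_wpM2l// l1_ge0.
Qed.

Definition evalc (R : rcfType) (p : {poly R}) (z : R[i]) : R[i] :=
  (map_poly (@real_complex R) p).[z].

Lemma evalcE (R : rcfType) (p : {poly R}) z N : (size p <= N)%N ->
  evalc p z = \sum_(i < N) (p`_i)%:C * z ^+ i.
Proof.
move=> pN; rewrite /evalc (horner_coef_wide z (n := N)); last first.
  by rewrite size_map_poly.
by apply: eq_bigr => i _; rewrite coef_map.
Qed.

Lemma normc_evalc (R : rcfType) (p : {poly R}) z : normc z <= 1 ->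
  normc (evalc p z) <= l1 p.
Proof.
move=> z1; rewrite (evalcE z (leqnn _)).
apply: le_trans (normc_sum _ _ _) _; apply: ler_sum => i _.
by rewrite normcM normcR normcX -[leRHS]mulr1 ler_wpM2l// exprn_ile1 ?normc_ge0.
Qed.

Lemma evalcM (R : rcfType) (p q : {poly R}) z : evalc (p * q) z = evalc p z * evalc q z.
Proof. by rewrite /evalc rmorphM hornerM. Qed.

Lemma evalcD (R : rcfType) (p q : {poly R}) z : evalc (p + q) z = evalc p z + evalc q z.
Proof. by rewrite /evalc rmorphD hornerD. Qed.

Lemma evalcN (R : rcfType) (p : {poly R}) z : evalc (- p) z = - evalc p z.
Proof. by rewrite /evalc rmorphN hornerN. Qed.

Lemma evalcX (R : rcfType) (p : {poly R}) z k : evalc (p ^+ k) z = evalc p z ^+ k.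
Proof. by rewrite /evalc rmorphXn horner_exp. Qed.

Lemma evalcZ (R : rcfType) (c : R) (p : {poly R}) z : evalc (c *: p) z = c%:C * evalc p z.
Proof. by rewrite /evalc linearZ /= hornerZ. Qed.

Lemma evalcXn (R : rcfType) z k : evalc ('X^k : {poly R}) z = z ^+ k.
Proof. by rewrite /evalc map_polyXn hornerXn. Qed.

Lemma evalc1 (R : rcfType) z : evalc (1 : {poly R}) z = 1.
Proof. by rewrite /evalc rmorph1 hornerC. Qed.

Lemma evalc_sum (R : rcfType) (I : Type) (r : seq I) (P : pred I) (F : I -> {poly R}) z :
  evalc (\sum_(i <- r | P i) F i) z = \sum_(i <- r | P i) evalc (F i) z.
Proof. by rewrite /evalc rmorph_sum horner_sum. Qed.

(** * Parseval at the roots of unity *)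

(** No aliasing occurs as long as the polynomial has at most [M] coefficients. *)
Lemma parseval (R : rcfType) (p : {poly R}) M w :
  M.-primitive_root w -> (size p <= M)%N ->
  \sum_(j < M) normc (evalc p (w ^+ j)) ^+ 2 = M%:R * \sum_(i < M) p`_i ^+ 2.
Proof.
move=> pw pM; apply: (@complexI R); rewrite rmorph_sum /= rmorphM rmorph_nat rmorph_sum /=.
under eq_bigr do rewrite sqr_normcE (evalcE _ pM) rmorph_sum mulr_suml.
rewrite exchange_big mulr_sumr /=; apply: eq_bigr => i _.
under eq_bigr do rewrite mulr_sumr.
rewrite exchange_big (bigD1 i)//= [X in _ + X]big1 ?addr0 => [|k ki].
  transitivity ((p`_i)%:C * (p`_i)%:C * \sum_(j < M) (w ^+ j) ^+ i * ((w ^+ j)^*) ^+ i).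
    rewrite mulr_sumr; apply: eq_bigr => j _.
    have c : conjC ((p`_i)%:C) = (p`_i)%:C by exact: conjc_real.
    by rewrite rmorphM rmorphXn /= c; ring.
  by rewrite (sum_prim_root _ _ pw) eqxx rmorphXn /= mulrC expr2.
transitivity ((p`_i)%:C * (p`_k)%:C * \sum_(j < M) (w ^+ j) ^+ i * ((w ^+ j)^*) ^+ k).
  rewrite mulr_sumr; apply: eq_bigr => j _.
  have c : conjC ((p`_k)%:C) = (p`_k)%:C by exact: conjc_real.
  by rewrite rmorphM rmorphXn /= c; ring.
rewrite (sum_prim_root _ _ pw) !modn_small//.
by rewrite eq_sym [_ == _](negbTE ki) mulr0.
Qed.

Lemma mean_evalc (R : rcfType) (p : {poly R}) M w :
  M.-primitive_root w -> (size p <= M)%N ->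
  \sum_(j < M) evalc p (w ^+ j) = M%:R * (p`_0)%:C.
Proof.
move=> pw pM; have M0 := prim_order_gt0 pw.
under eq_bigr do rewrite (evalcE _ pM).
rewrite exchange_big (bigD1 (Ordinal M0))//= [X in _ + X]big1 ?addr0 => [|i i0].
  by under eq_bigr do rewrite expr0 mulr1; rewrite sumr_const card_ord -[RHS]mulrC mulr_natr.
rewrite -mulr_sumr.
have := sum_prim_root i 0 pw.
under eq_bigr do rewrite expr0 mulr1; move=> ->.
rewrite !modn_small//; case: eqP => [i00|]; last by rewrite mulr0.
by case/eqP: i0; apply: val_inj.
Qed.

Lemma mean_Re_evalc (R : rcfType) (p : {poly R}) M w :
  M.-primitive_root w -> (size p <= M)%N ->
  \sum_(j < M) complex.Re (evalc p (w ^+ j)) = M%:R * p`_0.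
Proof.
move=> pw pM; rewrite -Re_sum (mean_evalc pw pM).
by rewrite -(rmorph_nat (@real_complex R)) Re_realM.
Qed.

(** * Truncated exponentials *)

Definition texp (A : comUnitRingType) (K : nat) (x : A) : A :=
  \sum_(k < K.+1) x ^+ k / k`!%:R.

(** The part of the product of two truncated exponentials that is missing from the truncated
    exponential of the sum. *)
Definition cross_terms (A : comUnitRingType) (K : nat) (x y : A) : A :=
  \sum_(i < K.+1) \sum_(j < K.+1 | (K < i + j)%N) (x ^+ i / i`!%:R) * (y ^+ j / j`!%:R).

Lemma texpM (A : comUnitRingType) (K : nat) (x y : A) :
  (forall k, (k`!%:R : A) \is a GRing.unit) ->
  texp K x * texp K y = texp K (x + y) + cross_terms K x y.
Proof.
move=> fu; rewrite /texp mulr_suml.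
under eq_bigr do rewrite mulr_sumr.
have -> : \sum_(i < K.+1) \sum_(j < K.+1) x ^+ i / i`!%:R * (y ^+ j / j`!%:R) =
  \sum_(i < K.+1) (\sum_(j < K.+1 | (i + j <= K)%N) x ^+ i / i`!%:R * (y ^+ j / j`!%:R) +
   \sum_(j < K.+1 | (K < i + j)%N) x ^+ i / i`!%:R * (y ^+ j / j`!%:R)).
  apply: eq_bigr => i _; rewrite (bigID (fun j : 'I_K.+1 => (i + j <= K)%N))/=.
  by congr (_ + _); apply: eq_bigl => j; rewrite ltnNge.
rewrite big_split /= -/(cross_terms K x y); congr (_ + _).
pose F i k := x ^+ i / i`!%:R * (y ^+ (k - i) / (k - i)`!%:R).
transitivity (\sum_(i < K.+1) \sum_(k < K.+1 | (i <= k)%N) F i k).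
  apply: eq_bigr => i _; have iK := ltn_ord i.
  rewrite -(big_mkord (fun j => (i + j <= K)%N) (fun j => x ^+ i / i`!%:R * (y ^+ j / j`!%:R))).
  rewrite -(big_mkord (fun k => (i <= k)%N) (fun k => F i k)).
  rewrite [RHS](@big_cat_nat _ _ _ i 0 K.+1)//=; last exact: ltnW.
  have -> : \sum_(0 <= k < i | (i <= k)%N) F i k = 0.
    by rewrite big_nat_cond big1// => k /andP[/andP[_ ki] ik]; move: ki; rewrite ltnNge ik.
  rewrite add0r [LHS](@big_cat_nat _ _ _ (K.+1 - i) 0 K.+1)//= ?leq_subr//.
  have -> : \sum_(K.+1 - i <= j < K.+1 | (i + j <= K)%N) x ^+ i / i`!%:R * (y ^+ j / j`!%:R) = 0.
    by rewrite big_nat_cond big1// => k /andP[/andP[k1 k2] k3]; lia.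
  have shift := big_addn 0 K.+1 i (fun k => (i <= k)%N) (fun k => F i k).
  rewrite add0n in shift; rewrite addr0 shift big_nat_cond [RHS]big_nat_cond.
  apply: eq_big => k; first by lia.
  by move=> _; rewrite /F addnK.
rewrite (exchange_big_dep xpredT)//=; apply: eq_bigr => k _; have kK := ltn_ord k.
rewrite (addrC x) exprDn mulr_suml.
rewrite -(big_mkord (fun i => (i <= k)%N) (fun i => F i k)).
rewrite (@big_cat_nat _ _ _ k.+1 0 K.+1)//=.
have -> : \sum_(k.+1 <= i < K.+1 | (i <= k)%N) F i k = 0.
  by rewrite big_nat_cond big1// => i /andP[/andP[k1 k2] k3]; lia.
rewrite addr0 big_mkord; apply: eq_big => [i|i _]; first by rewrite -ltnS ltn_ord.
rewrite /F.
have ik : (i <= k)%N by rewrite -ltnS.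
apply: (mulIr (fu k)); rewrite mulrVK// -(bin_fact ik) natrM natrM -[RHS]mulr_natr.
set a : A := i`!%:R; set b : A := (k - i)`!%:R; set c : A := 'C(k, i)%:R.
have aK : a^-1 * a = 1 by rewrite mulVr// fu.
have bK : b^-1 * b = 1 by rewrite mulVr// fu.
transitivity (y ^+ (k - i) * x ^+ i * c * (a^-1 * a) * (b^-1 * b)); first by ring.
by rewrite aK bK !mulr1.
Qed.

Lemma fact_unit_field (F : numFieldType) k : (k`!%:R : F) \is a GRing.unit.
Proof. by rewrite unitfE pnatr_eq0 -lt0n fact_gt0. Qed.

Lemma fact_poly (F : numFieldType) k : (k`!%:R : {poly F})^-1 = (k`!%:R^-1)%:P.
Proof. by rewrite -(rmorph_nat (@polyC F)) rmorphV// fact_unit_field. Qed.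

Lemma fact_unit_poly (F : numFieldType) k : (k`!%:R : {poly F}) \is a GRing.unit.
Proof. by rewrite -(rmorph_nat (@polyC F)) rmorph_unit// fact_unit_field. Qed.

Lemma texp_poly (F : numFieldType) K (p : {poly F}) :
  texp K p = \sum_(k < K.+1) k`!%:R^-1 *: p ^+ k.
Proof. by apply: eq_bigr => k _; rewrite fact_poly mulrC mul_polyC. Qed.

Lemma evalc_texp (R : rcfType) K (p : {poly R}) z : evalc (texp K p) z = texp K (evalc p z).
Proof.
rewrite texp_poly evalc_sum; apply: eq_bigr => k _.
by rewrite evalcZ evalcX fmorphV rmorph_nat mulrC.
Qed.

Lemma texp_real (R : rcfType) K (x : R) : (texp K x)%:C = texp K (x%:C).
Proof.
rewrite /texp rmorph_sum; apply: eq_bigr => k _.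
by rewrite rmorphM rmorphXn fmorphV rmorph_nat.
Qed.

Lemma texp_conj (R : rcfType) K (z : R[i]) : texp K (z^*) = (texp K z)^*.
Proof.
rewrite /texp rmorph_sum; apply: eq_bigr => k _.
by rewrite rmorphM rmorphXn fmorphV rmorph_nat.
Qed.

Lemma texp_cvg (R : realType) (x : R) : texp K x @[K --> \oo] --> expR x.
Proof.
have h := @is_cvg_series_exp_coeff R x.
have h' : series (exp_coeff x) K.+1 @[K --> \oo] --> expR x.
  by rewrite (cvg_shiftS (series (exp_coeff x))).
apply: cvg_trans h'; apply: near_eq_cvg; apply: nearW => K.
by rewrite /series /= big_mkord.
Qed.

Lemma texp_le_expR (R : realType) K (x : R) : 0 <= x -> texp K x <= expR x.
Proof.
move=> x0; rewrite -(cvg_lim _ (@texp_cvg R x))//.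
apply: limr_ge; first by apply/cvg_ex; exists (expR x); exact: texp_cvg.
near=> M; have KM : (K <= M)%N by near: M; exact: nbhs_infty_ge.
rewrite /texp -!(big_mkord xpredT (fun k => x ^+ k / k`!%:R)).
rewrite (@big_cat_nat _ _ _ K.+1 0 M.+1)//= lerDl sumr_ge0// => k _.
by rewrite divr_ge0 ?exprn_ge0.
Unshelve. all: by end_near. Qed.

Lemma size_texp (R : realType) K (g : {poly R}) : (size (texp K g) <= (K * size g).+1)%N.
Proof.
rewrite texp_poly; apply: leq_trans (size_sum _ _ _) _; apply/bigmax_leqP => k _.
apply: leq_trans (size_scale_leq _ _) _; apply: leq_trans (size_poly_exp_leq _ _) _.
rewrite ltnS mulnC leq_mul//; [by rewrite -ltnS | exact: leq_pred].
Qed.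

Definition texp_tail (R : realType) K (rho : R) : R := expR rho - texp K rho.

Lemma texp_tail_cvg (R : realType) (rho : R) : texp_tail K rho @[K --> \oo] --> (0 : R).
Proof. by rewrite -(subrr (expR rho)); apply: cvgB; [exact: cvg_cst|exact: texp_cvg]. Qed.

Lemma texp_block_le (R : realType) K K' (x : R) : (K <= K')%N -> 0 <= x ->
  \sum_(K.+1 <= k < K'.+1) x ^+ k / k`!%:R <= texp_tail K x.
Proof.
move=> KK' x0; rewrite /texp_tail lerBrDl; apply: le_trans (texp_le_expR K' x0).
rewrite /texp -!(big_mkord xpredT (fun k => x ^+ k / k`!%:R)).
by rewrite [leRHS](@big_cat_nat _ _ _ K.+1 0 K'.+1).
Qed.

Lemma l1_texp_tail (R : realType) K K' (p : {poly R}) : (K <= K')%N ->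
  l1 (texp K' p - texp K p) <= texp_tail K (l1 p).
Proof.
move=> KK'; apply: le_trans (texp_block_le KK' (l1_ge0 _)).
have -> : texp K' p - texp K p = \sum_(K.+1 <= k < K'.+1) k`!%:R^-1 *: p ^+ k.
  rewrite !texp_poly -!(big_mkord xpredT (fun k => k`!%:R^-1 *: p ^+ k)).
  by rewrite (@big_cat_nat _ _ _ K.+1 0 K'.+1)//= addrAC subrr add0r.
apply: le_trans (l1_sum _ _ _) _; apply: ler_sum => k _.
by rewrite l1Z ger0_norm// mulrC ler_wpM2r// l1X.
Qed.

Lemma l1_texp (R : realType) K (p : {poly R}) : l1 (texp K p) <= expR (l1 p).
Proof.
apply: le_trans (texp_le_expR K (l1_ge0 _)); rewrite texp_poly.
apply: le_trans (l1_sum _ _ _) _; apply: ler_sum => k _.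
by rewrite l1Z ger0_norm// mulrC ler_wpM2r// l1X.
Qed.

Definition texp_err (R : realType) K (rho : R) : R :=
  cross_terms K rho rho + texp_tail K (2 * rho).

Lemma texp_err_cvg (R : realType) (rho : R) : texp_err K rho @[K --> \oo] --> (0 : R).
Proof.
apply: null_add; last exact: texp_tail_cvg.
have -> : (fun K => cross_terms K rho rho) = fun K => texp K rho * texp K rho - texp K (rho + rho).
  apply/funext => K; rewrite texpM; last exact: fact_unit_field.
  by rewrite addrAC subrr add0r.
rewrite -(subrr (expR (rho + rho))) {1}expRD; apply: cvgB; last exact: texp_cvg.
by apply: cvgM; exact: texp_cvg.
Qed.

(** The identity [|exp z|^2 = exp (2 Re z)] for truncated exponentials: the product of
    [texp K z] and its conjugate differs from [texp K (2 Re z)] by cross terms, and those are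
    dominated by the cross terms for [|z|]. *)
Lemma texp_sqr_norm (R : realType) K (z : R[i]) (rho : R) : normc z <= rho ->
  `| normc (texp K z) ^+ 2 - expR (2 * complex.Re z) | <= texp_err K rho.
Proof.
move=> zr; have rho0 : 0 <= rho := le_trans (normc_ge0 _) zr.
have E : (normc (texp K z) ^+ 2)%:C = (texp K (2 * complex.Re z))%:C + cross_terms K z (z^*).
  rewrite sqr_normcE -texp_conj texpM; last exact: fact_unit_field.
  by rewrite texp_real -addc_conj.
rewrite -normcR.
have -> : (normc (texp K z) ^+ 2 - expR (2 * complex.Re z))%:C =
  ((texp K (2 * complex.Re z))%:C - (expR (2 * complex.Re z))%:C) + cross_terms K z (z^*).
  by rewrite addrAC -E; exact: rmorphB.
apply: le_trans (normcD _ _) _.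
rewrite addrC; apply: lerD.
  apply: le_trans (normc_sum _ _ _) _; apply: ler_sum => i _.
  apply: le_trans (normc_sum _ _ _) _; apply: ler_sum => j _.
  have nzc : normc (conjC z) = normc z := normc_conj z.
  rewrite !normcM !normcV !normcX !normc_nat nzc.
  by rewrite ler_pM ?mulr_ge0 ?exprn_ge0 ?invr_ge0 ?normc_ge0// ler_wpM2r ?invr_ge0//
    lerXn2r ?nnegrE ?normc_ge0.
rewrite -rmorphB normcR; set x := 2 * complex.Re z.
have xr : `|x| <= 2 * rho.
  by rewrite /x normrM ger0_norm// ler_pM2l// (le_trans (Re_normc _)).
(* The remaining error is the tail of a real exponential series. *)
pose D M := \sum_(K.+1 <= k < M.+1) x ^+ k / k`!%:R.
have DE M : (K <= M)%N -> texp M x - texp K x = D M.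
  move=> KM; rewrite /texp -!(big_mkord xpredT (fun k => x ^+ k / k`!%:R)).
  by rewrite (@big_cat_nat _ _ _ K.+1 0 M.+1)//= addrAC subrr add0r.
have Dle M : (K <= M)%N -> `|D M| <= texp_tail K (2 * rho).
  move=> KM; apply: le_trans (texp_block_le KM _); last by rewrite mulr_ge0.
  apply: le_trans (ler_norm_sum _ _ _) _; apply: ler_sum => k _.
  by rewrite normrM normrX [`|_^-1|]ger0_norm// ler_wpM2r ?invr_ge0// lerXn2r ?nnegrE ?mulr_ge0.
rewrite distrC; apply: (@limr_le_null _ (fun M => `|D (M + K)%N|) _ _ (fun=> 0)).
- apply: cvg_norm; under eq_fun do rewrite -DE ?leq_addl//.
  apply: cvgB; last exact: cvg_cst.
  rewrite (cvg_shiftn K (fun M => texp M x)); exact: texp_cvg.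
- exact: cvg_cst.
- by move=> M; rewrite addr0; apply: Dle; rewrite leq_addl.
Qed.

(** * Low-order coefficients of truncated exponentials *)

Definition vanish (R : nzRingType) (n : nat) (p : {poly R}) :=
  forall i, (i < n)%N -> p`_i = 0.

Lemma vanishM (R : nzRingType) m n (p q : {poly R}) :
  vanish m p -> vanish n q -> vanish (m + n) (p * q).
Proof.
move=> vp vq i imn; rewrite coefM big1// => j _.
case: (ltnP j m) => jm; first by rewrite vp// mul0r.
by rewrite vq ?mulr0//; have := ltn_ord j; lia.
Qed.

Lemma vanishX (R : nzRingType) (p : {poly R}) k : vanish 1 p -> vanish k (p ^+ k).
Proof.
move=> vp; elim: k => [|k IH] //; rewrite exprS -add1n; exact: vanishM.
Qed.

(** Since [p] has no constant term, [p^k] does not reach the coefficient [n < k]: the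
    coefficients of the formal exponential are finite sums. *)
Lemma texp_coef_stable (F : numFieldType) (p : {poly F}) n K K' : vanish 1 p ->
  (n <= K)%N -> (K <= K')%N -> (texp K' p)`_n = (texp K p)`_n.
Proof.
move=> vp nK KK'; rewrite !texp_poly !coef_sum.
rewrite -!(big_mkord xpredT (fun k => (k`!%:R^-1 *: p ^+ k)`_n)).
rewrite (@big_cat_nat _ _ _ K.+1 0 K'.+1)//= [X in _ + X]big_nat [X in _ + X]big1 ?addr0// => k /andP[k1 k2].
by rewrite coefZ (vanishX vp) ?mulr0//; lia.
Qed.

(** Cross terms have order larger than [K]. *)
Lemma texpM_coef (F : numFieldType) (p q : {poly F}) n K : vanish 1 p -> vanish 1 q ->
  (n <= K)%N -> (texp K p * texp K q)`_n = (texp K (p + q))`_n.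
Proof.
move=> vp vq nK; rewrite texpM; last exact: fact_unit_poly.
rewrite coefD [X in _ + X](_ : _ = 0) ?addr0//.
rewrite /cross_terms coef_sum big1// => i _; rewrite coef_sum big1// => j ij.
rewrite !fact_poly !(mulrC (_ ^+ _)) !mul_polyC -scalerAl -scalerAr !coefZ.
by rewrite (vanishM (vanishX vp) (vanishX vq)) ?mulr0//; lia.
Qed.

Lemma texp_coef_congr (F : numFieldType) (p q : {poly F}) L K n :
  vanish L (p - q) -> (n < L)%N -> (texp K p)`_n = (texp K q)`_n.
Proof.
move=> v nL; rewrite !texp_poly !coef_sum; apply: eq_bigr => k _.
rewrite !coefZ; congr (_ * _).
apply/eqP; rewrite -subr_eq0 -coefB subrXX.
have := @vanishM _ L 0 (p - q) (\sum_(i < k) p ^+ (k.-1 - i) * q ^+ i) v.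
by rewrite addn0; move=> ->.
Qed.

(** * Fejer kernels and the lacunary step *)

Definition dirichlet (R : rcfType) (m : nat) (y : R[i]) : R[i] := \sum_(j < m) y ^+ j.

Lemma sqr_normcD (R : rcfType) (a b : R[i]) :
  normc (a + b) ^+ 2 = normc a ^+ 2 + normc b ^+ 2 + 2 * complex.Re (b * a^*).
Proof.
apply: (@complexI R); rewrite !rmorphD /= !sqr_normcE -addc_conj !rmorphD !rmorphM /= conjCK.
by ring.
Qed.

(** Induction on [m]: adding the term [y^m] to the Dirichlet kernel adds
    [1 + 2 sum_(1 <= k <= m) Re y^k] to the square of its modulus. *)
Lemma fejer (R : rcfType) (m : nat) (y : R[i]) : normc y = 1 ->
  normc (dirichlet m y) ^+ 2 =
  m%:R + 2 * \sum_(k < m) (m%:R - k.+1%:R) * complex.Re (y ^+ k.+1).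
Proof.
move=> y1; have yc := unimod_conj y1.
elim: m => [|m IH]; first by rewrite /dirichlet !big_ord0 normc0 expr0n mulr0 addr0.
rewrite /dirichlet big_ord_recr /= sqr_normcD -/(dirichlet m y) IH normcX y1 !expr1n.
have -> : complex.Re (y ^+ m * conjC (dirichlet m y)) = \sum_(k < m) complex.Re (y ^+ k.+1).
  rewrite /dirichlet rmorph_sum mulr_sumr Re_sum (reindex_inj rev_ord_inj) /=.
  apply: eq_bigr => k _; congr complex.Re; rewrite rmorphXn /=.
  have km := ltn_ord k.
  by rewrite -{1}(subnK km) exprD mulrAC -exprMn yc expr1n mul1r.
rewrite big_ord_recr /= subrr mul0r addr0 -[m.+1%:R]natr1.
have -> : \sum_(i < m) (m%:R + 1 - i.+1%:R) * complex.Re (y ^+ i.+1) =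
  \sum_(i < m) (m%:R - i.+1%:R) * complex.Re (y ^+ i.+1) + \sum_(i < m) complex.Re (y ^+ i.+1).
  by rewrite -big_split /=; apply: eq_bigr => i _; ring.
by ring.
Qed.

(** On the circle this is [z^(size h)] times the conjugate of [h]. *)
Definition revp (R : nzRingType) (h : {poly R}) : {poly R} :=
  \sum_(i < size h) h`_i *: 'X^(size h - i).

(** On the circle, with [N = L + size h], the new polynomial is
    [h + 2 Re h * sum_(0 < k <= m) (1 - k/m) z^(k N)]: multiplying the real part by the
    Fejer kernel at [z^N] keeps the holomorphic completion a polynomial, because [z^N] times
    the conjugate of [h] has only frequencies larger than [L]. *)
Definition lac_step (R : numFieldType) (h : {poly R}) (L m : nat) : {poly R} :=
  h + 'X^L * ((('X^(size h) * h) + revp h) *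
    \sum_(k < m) (1 - k.+1%:R / m%:R) *: 'X^(k * (L + size h))).

Lemma revp_eval (R : rcfType) (h : {poly R}) z : normc z = 1 ->
  evalc (revp h) z = z ^+ size h * (evalc h z)^*.
Proof.
move=> z1; have zc := unimod_conj z1.
rewrite /revp evalc_sum (evalcE _ (leqnn _)) rmorph_sum mulr_sumr; apply: eq_bigr => i _.
have c : conjC ((h`_i)%:C) = (h`_i)%:C by exact: conjc_real.
rewrite evalcZ evalcXn rmorphM rmorphXn /= c mulrCA; congr (_ * _).
have ih := ltnW (ltn_ord i).
have -> : z ^+ size h = z ^+ (size h - i) * z ^+ i by rewrite -exprD subnK.
by rewrite -mulrA -exprMn zc expr1n mulr1.
Qed.

Lemma Re_lac_step (R : rcfType) (h : {poly R}) L m z : (0 < m)%N -> normc z = 1 ->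
  complex.Re (evalc (lac_step h L m) z) =
  complex.Re (evalc h z) * (normc (dirichlet m (z ^+ (L + size h))) ^+ 2 / m%:R).
Proof.
move=> m0 z1; set N := (L + size h)%N.
have m0' : m%:R != 0 :> R by rewrite pnatr_eq0 -lt0n.
have zN1 : normc (z ^+ N) = 1 by rewrite normcX z1 expr1n.
rewrite (fejer m zN1) /lac_step evalcD ReD !evalcM evalcD evalcM !evalcXn revp_eval//.
rewrite -mulrDr addc_conj evalc_sum -/N.
set u := complex.Re (evalc h z).
have -> : z ^+ L * (z ^+ size h * (2 * u)%:C *
   \sum_(i < m) evalc ((1 - i.+1%:R / m%:R) *: 'X^(i * N)) z) =
  (2 * u)%:C * \sum_(i < m) ((1 - i.+1%:R / m%:R)%:C * (z ^+ N) ^+ i.+1).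
  rewrite !mulr_sumr; apply: eq_bigr => i _.
  rewrite evalcZ evalcXn -exprM mulnS exprD [z ^+ N]exprD mulnC; ring.
rewrite Re_realM Re_sum (mulrDl _ _ (m%:R^-1)) divff// mulrDr mulr1; congr (_ + _).
rewrite -!mulrA mulr_suml mulrCA; congr (_ * (_ * _)); apply: eq_bigr => i _.
by rewrite Re_realM; field.
Qed.

Lemma lac_step_low (R : numFieldType) (h : {poly R}) L m : vanish L (lac_step h L m - h).
Proof. by move=> i iL; rewrite /lac_step addrAC subrr add0r coefXnM iL. Qed.

Lemma l1_revp (R : numFieldType) (h : {poly R}) : l1 (revp h) <= l1 h.
Proof.
apply: le_trans (l1_sum _ _ _) _; apply: ler_sum => i _.
by rewrite l1Z -['X^_]mulr1 l1MXn l1_1 mulr1.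
Qed.

Lemma l1_lac_step (R : numFieldType) (h : {poly R}) L m :
  l1 (lac_step h L m) <= l1 h * (1 + 2 * m%:R).
Proof.
rewrite mulrDr mulr1; apply: le_trans (l1D _ _) _; rewrite lerD2l l1MXn.
apply: le_trans (l1M _ _) _; rewrite mulrA; apply: ler_pM => //; try exact: l1_ge0.
  apply: le_trans (l1D _ _) _; rewrite l1MXn mulrC mulr2n mulrDl mul1r lerD2l; exact: l1_revp.
apply: le_trans (l1_sum _ _ _) _.
apply: (@le_trans _ _ (\sum_(k < m) 1)); last by rewrite sumr_const card_ord.
apply: ler_sum => k _; rewrite l1Z -['X^_]mulr1 l1MXn l1_1 mulr1.
have km := ltn_ord k.
have m0 : 0 < m%:R :> R by rewrite ltr0n (leq_trans _ km).
have h1 : 0 <= (k.+1%:R / m%:R : R) <= 1.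
  by rewrite divr_ge0//= ler_pdivrMr// mul1r ler_nat.
case/andP: h1 => h1 h2.
by rewrite ger0_norm ?subr_ge0// gerBl.
Qed.

(** * Concentration of the Fejer kernel *)

Lemma dirichlet_geo (R : rcfType) m (y : R[i]) : (1 - y) * dirichlet m y = 1 - y ^+ m.
Proof. by rewrite /dirichlet -opprB mulNr -subrX1 opprB. Qed.

(** The term [y^j] of the kernel is within [j/n] of 1. *)
Lemma dirichlet_near1 (R : rcfType) n (y : R[i]) : normc y = 1 -> (0 < n)%N ->
  normc (1 - y) < n%:R^-1 -> n%:R / 2 <= normc (dirichlet n y).
Proof.
move=> y1 n0 hy; have n0' : 0 < n%:R :> R by rewrite ltr0n.
have pw j : normc (1 - y ^+ j) <= j%:R * normc (1 - y).
  rewrite -dirichlet_geo normcM mulrC ler_wpM2r ?normc_ge0//.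
  apply: le_trans (normc_sum _ _ _) _.
  under eq_bigr do rewrite normcX y1 expr1n.
  by rewrite sumr_const card_ord.
have : normc (n%:R - dirichlet n y) <= n%:R / 2.
  have -> : n%:R - dirichlet n y = \sum_(j < n) (1 - y ^+ j).
    by rewrite sumrB sumr_const card_ord.
  apply: le_trans (normc_sum _ _ _) _.
  apply: (@le_trans _ _ (\sum_(j < n) j%:R * normc (1 - y))).
    by apply: ler_sum => j _; exact: pw.
  rewrite -mulr_suml.
  apply: (@le_trans _ _ ((\sum_(j < n) j%:R) / n%:R)).
    by rewrite ler_wpM2l ?sumr_ge0// ltW.
  rewrite ler_pdivrMr// -natr_sum.
  have gauss k : ((\sum_(j < k) j) * 2 <= k * k)%N.
    elim: k => [|k]; first by rewrite big_ord0.
    by rewrite big_ord_recr /=; move: (\sum_(j < k) (j : nat))%N => s; nia.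
  have : (\sum_(j < n) j)%:R * 2 <= n%:R * n%:R :> R by rewrite -!natrM ler_nat.
  by move=> ?; lra.
have := normcD (n%:R - dirichlet n y) (dirichlet n y).
rewrite subrK normc_nat; lra.
Qed.

Lemma dirichlet_away1 (R : rcfType) m n (y : R[i]) : normc y = 1 -> (0 < n)%N ->
  n%:R^-1 <= normc (1 - y) -> normc (dirichlet m y) <= 2 * n%:R.
Proof.
move=> y1 n0 hy; have n0' : 0 < n%:R :> R by rewrite ltr0n.
have h1 : normc (1 - y) * normc (dirichlet m y) <= 2.
  rewrite -normcM dirichlet_geo; apply: le_trans (normcB _ _) _.
  by rewrite normc1 normcX y1 expr1n.
rewrite -(ler_pM2l (_ : 0 < n%:R^-1)) ?invr_gt0// mulrCA mulVf ?gt_eqF// mulr1.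
apply: le_trans h1; by rewrite ler_wpM2r ?normc_ge0.
Qed.

(** Within [1/n] of 1 the left side is at most 1, and there the square of [dirichlet n] is at
    least [n^2 / 4]. Elsewhere the Fejer kernel of order [n^3] is at most
    [(2 n)^2 / n^3 = 4 / n], so that the exponent is at most [8 u / n]. *)
Lemma one_minus_exp_le (R : realType) (u : R) (n : nat) (y : R[i]) : normc y = 1 ->
  (0 < n)%N -> 0 <= u ->
  1 - expR (- (2 * (u * (normc (dirichlet (n ^ 3) y) ^+ 2 / (n ^ 3)%:R)))) <=
  8 / n%:R * u + 4 / n%:R ^+ 2 * normc (dirichlet n y) ^+ 2.
Proof.
move=> y1 n0 u0; have n0' : 0 < n%:R :> R by rewrite ltr0n.
set v := normc (dirichlet (n ^ 3) y) ^+ 2 / (n ^ 3)%:R.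
have v0 : 0 <= v by rewrite divr_ge0 ?sqr_ge0.
have [hy|hy] := ltP (normc (1 - y)) n%:R^-1.
  have h1 := dirichlet_near1 y1 n0 hy.
  have : 1 <= 4 / n%:R ^+ 2 * normc (dirichlet n y) ^+ 2.
    have h2 : (n%:R / 2) ^+ 2 <= normc (dirichlet n y) ^+ 2.
      by rewrite lerXn2r ?nnegrE ?normc_ge0 ?divr_ge0.
    have e1 : 4 / n%:R ^+ 2 * (n%:R / 2) ^+ 2 = 1 :> R by field; rewrite gt_eqF.
    by rewrite -[leLHS]e1 ler_wpM2l// divr_ge0 ?exprn_ge0// ltW.
  have := expR_gt0 (- (2 * (u * v))).
  have : 0 <= 8 / n%:R * u by rewrite !mulr_ge0// invr_ge0 ltW.
  lra.
have h1 := dirichlet_away1 (n ^ 3) y1 n0 hy.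
have vle : v <= 4 / n%:R.
  rewrite /v ler_pdivrMr ?ltr0n ?expn_gt0 ?n0//.
  have -> : 4 / n%:R * (n ^ 3)%:R = (2 * n%:R) ^+ 2 :> R.
    by rewrite natrX; field; rewrite gt_eqF.
  by rewrite lerXn2r ?nnegrE ?normc_ge0 ?mulr_ge0// ltW.
have h2 := expR_ge1Dx (- (2 * (u * v))).
have h3 : 0 <= 4 / n%:R ^+ 2 * normc (dirichlet n y) ^+ 2.
  by rewrite mulr_ge0 ?sqr_ge0// divr_ge0 ?exprn_ge0// ltW.
have h4 : u * v <= u * (4 / n%:R) by rewrite ler_wpM2l.
have -> : 8 / n%:R * u = 2 * (u * (4 / n%:R)) by ring.
lra.
Qed.

Definition re_pos (R : rcfType) (h : {poly R}) :=
  forall z, normc z = 1 -> 0 <= complex.Re (evalc h z).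

Lemma mean_dirichlet (R : rcfType) M w n N : M.-primitive_root w -> (0 < N)%N ->
  (n * N <= M)%N ->
  \sum_(j < M) normc (dirichlet n ((w ^+ j : R[i]) ^+ N)) ^+ 2 = M%:R * n%:R.
Proof.
(* All the coefficients are 0 or 1, so their squares add up to the value at 1. *)
move=> pw N0 nM; pose p : {poly R} := \sum_(i < n) 'X^(i * N).
have pE z : evalc p z = dirichlet n (z ^+ N).
  by rewrite /p evalc_sum; apply: eq_bigr => i _; rewrite evalcXn mulnC exprM.
have ps : (size p <= M)%N.
  apply: leq_trans (size_sum _ _ _) _; apply/bigmax_leqP => i _.
  by rewrite size_polyXn; apply: leq_trans nM; rewrite ltn_mul2r N0 ltn_ord.
under eq_bigr do rewrite -pE.
rewrite (parseval pw ps); congr (_ * _).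
have p01 i : p`_i ^+ 2 = p`_i.
  have [[k ik]|h] := pselect (exists k : 'I_n, i = (k * N)%N).
    rewrite /p coef_sum (bigD1 k)//= big1 ?addr0 ?coefXn ?ik ?eqxx ?expr1n// => j jk.
    rewrite coefXn eqn_pmul2r//; case: eqP => // kj; case/eqP: jk; exact: val_inj.
  rewrite /p coef_sum big1 ?expr0n// => k _; rewrite coefXn.
  by case: eqP => // ik; case: h; exists k.
under eq_bigr do rewrite p01.
have -> : \sum_(i < M) p`_i = p.[1].
  by rewrite (horner_coef_wide _ ps); apply: eq_bigr => i _; rewrite expr1n mulr1.
rewrite /p horner_sum; under eq_bigr do rewrite hornerXn expr1n.
by rewrite sumr_const card_ord.
Qed.

(** The mean of [Re h] is 1 and the mean of [|dirichlet n|^2] is [n], whence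
    [8/n + 4/n]. *)
Lemma mean_one_minus_exp (R : realType) (h : {poly R}) (L n M : nat) w :
  h`_0 = 1 -> re_pos h -> (0 < n)%N -> (0 < L)%N ->
  M.-primitive_root w -> (size h <= M)%N -> (n * (L + size h) <= M)%N ->
  \sum_(j < M) (1 - expR (- (2 * complex.Re (evalc (lac_step h L (n ^ 3)) (w ^+ j))))) <=
  M%:R * (12 / n%:R).
Proof.
move=> h0 hp n0 L0 pw hM nM; have n0' : 0 < n%:R :> R by rewrite ltr0n.
have w1 j : normc (w ^+ j) = 1 by rewrite normcX (prim_root_normc pw) expr1n.
apply: (@le_trans _ _ (\sum_(j < M) (8 / n%:R * complex.Re (evalc h (w ^+ j)) +
   4 / n%:R ^+ 2 * normc (dirichlet n ((w ^+ j) ^+ (L + size h))) ^+ 2))).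
  apply: ler_sum => j _; rewrite Re_lac_step ?expn_gt0 ?n0//.
  by apply: one_minus_exp_le => //; [rewrite normcX w1 expr1n | exact: hp].
rewrite big_split /= -!mulr_sumr (mean_Re_evalc pw hM) h0.
rewrite mean_dirichlet ?addn_gt0 ?L0//.
rewrite (_ : _ + _ = M%:R * (12 / n%:R))//; field; rewrite gt_eqF//.
Qed.

(** * Positivity of the real part inside the disc *)

(** The kernel is [1 + 2 sum_(0 < k < D) (conj(zeta) z)^k], a truncation of
    [(1 + conj(zeta) z) / (1 - conj(zeta) z)]; its mean against [2 Re h = h + conj(h)] picks
    the coefficients of [h] up to size [D]. *)
Lemma poisson (R : rcfType) (h : {poly R}) D M w z :
  M.-primitive_root w -> (size h <= D)%N -> (size h + D <= M)%N -> h`_0 = 1 -> (0 < D)%N ->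
  \sum_(j < M) (complex.Re (evalc h (w ^+ j)))%:C * (2 * dirichlet D ((w ^+ j)^* * z) - 1) =
  M%:R * evalc h z.
Proof.
move=> pw hD hM h0 D0.
have DM : (D <= M)%N by apply: leq_trans hM; rewrite leq_addl.
have sM : (size h <= M)%N by apply: leq_trans hM; rewrite leq_addr.
have M0 := prim_order_gt0 pw.
apply: (@mulfI _ 2); first by rewrite pnatr_eq0.
have E0 : \sum_(j < M) evalc h (w ^+ j) = M%:R by rewrite (mean_evalc pw sM) h0 mulr1.
have E0c : \sum_(j < M) (evalc h (w ^+ j))^* = M%:R by rewrite -rmorph_sum E0 rmorph_nat.
have E1 : \sum_(j < M) evalc h (w ^+ j) * dirichlet D ((w ^+ j)^* * z) = M%:R * evalc h z.
  under eq_bigr do rewrite (evalcE _ hD) /dirichlet mulr_suml.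
  rewrite exchange_big (evalcE _ hD) mulr_sumr /=; apply: eq_bigr => i _.
  under eq_bigr do rewrite mulr_sumr.
  rewrite exchange_big (bigD1 i)//= [X in _ + X]big1 ?addr0 => [|k ki].
    transitivity ((h`_i)%:C * z ^+ i * \sum_(j < M) (w ^+ j) ^+ i * ((w ^+ j)^*) ^+ i).
      by rewrite mulr_sumr; apply: eq_bigr => j _; rewrite exprMn; ring.
    by rewrite (sum_prim_root _ _ pw) eqxx mulrC.
  transitivity ((h`_i)%:C * z ^+ k * \sum_(j < M) (w ^+ j) ^+ i * ((w ^+ j)^*) ^+ k).
    by rewrite mulr_sumr; apply: eq_bigr => j _; rewrite exprMn; ring.
  rewrite (sum_prim_root _ _ pw) !modn_small ?(leq_trans (ltn_ord _) DM)//.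
  by rewrite eq_sym [_ == _](negbTE ki) mulr0.
have E2 : \sum_(j < M) (evalc h (w ^+ j))^* * dirichlet D ((w ^+ j)^* * z) = M%:R.
  rewrite -[RHS]E0c; apply/eqP; rewrite -subr_eq0 -sumrB; apply/eqP.
  have -> : D = D.-1.+1 by rewrite prednK.
  under eq_bigr do rewrite /dirichlet big_ord_recl expr0 mulrDr mulr1 addrAC subrr add0r
    (evalcE _ (leqnn _)) rmorph_sum mulr_suml.
  rewrite exchange_big big1//= => i _.
  under eq_bigr do rewrite mulr_sumr.
  rewrite exchange_big big1//= => k _.
  transitivity ((h`_i)%:C * z ^+ k.+1 * \sum_(j < M) (w ^+ j) ^+ 0 * ((w ^+ j)^*) ^+ (i + k.+1)).
    rewrite mulr_sumr; apply: eq_bigr => j _.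
    have c : conjC ((h`_i)%:C) = (h`_i)%:C by exact: conjc_real.
    have ci : conjC ((w ^+ j) ^+ i) = (conjC (w ^+ j)) ^+ i by exact: rmorphXn.
    by rewrite rmorphM /= c ci /bump /= add1n exprMn exprD expr0; ring.
  have ikM : (i + k.+1 < M)%N.
    rewrite -addSn; apply: leq_trans (leq_add (ltn_ord i) (ltn_ord k)) _.
    by apply: leq_trans hM; rewrite leq_add2l leq_pred.
  by rewrite (sum_prim_root _ _ pw) mod0n modn_small// addnS mulr0.
transitivity (\sum_(j < M) (2 * (evalc h (w ^+ j) * dirichlet D ((w ^+ j)^* * z)) +
  2 * ((evalc h (w ^+ j))^* * dirichlet D ((w ^+ j)^* * z)) - evalc h (w ^+ j) - (evalc h (w ^+ j))^*)).
  rewrite mulr_sumr; apply: eq_bigr => j _.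
  have A := addc_conj (evalc h (w ^+ j)).
  have twoRe (x : R) : (2 * x)%:C = 2 * x%:C by rewrite rmorphM rmorph_nat.
  move: A; rewrite twoRe; move: (complex.Re _)%:C => x.
  move: (evalc h _) => a; move: (dirichlet D _) => t A.
  transitivity ((2 * x) * (2 * t - 1)); first by ring.
  by rewrite -A; ring.
by rewrite !sumrB big_split /= -!mulr_sumr E1 E2 E0 E0c; ring.
Qed.

(** The kernel of [poisson] has real part at least [(1 - r)/(1 + r) - 2 r^D/(1 - r)] when
    [|z| = r], and [Re h] has mean 1. *)
Lemma herglotz_bound (R : realType) (h : {poly R}) z :
  h`_0 = 1 -> re_pos h -> normc z < 1 ->
  (1 - normc z) / (1 + normc z) <= complex.Re (evalc h z).
Proof.
move=> h0 hp z1; have z0 := normc_ge0 z; set r := normc z.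
apply: (@le_null _ _ _ (fun k => 2 / (1 - r) * r ^+ (k + (size h).+1))).
  by rewrite (cvg_shiftn (size h).+1 (fun k => 2 / (1 - r) * r ^+ k)); apply: null_geo; rewrite z0.
move=> k; set D := (k + (size h).+1)%N; set M := (size h + D)%N.
have M0 : (0 < M)%N by rewrite /M /D; lia.
have [w pw] := prim_root_exists R M0.
have w1 j : normc (w ^+ j) = 1 by rewrite normcX (prim_root_normc pw) expr1n.
have hD : (size h <= D)%N by rewrite /D; lia.
have D0 : (0 < D)%N by rewrite /D; lia.
have E := poisson z pw hD (leqnn M) h0 D0.
have M0' : 0 < M%:R :> R by rewrite ltr0n.
rewrite -(ler_pM2l M0') mulrDr.
have -> : M%:R * complex.Re (evalc h z) =
  \sum_(j < M) complex.Re (evalc h (w ^+ j)) * complex.Re (2 * dirichlet D ((w ^+ j)^* * z) - 1).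
  rewrite -Re_realM rmorph_nat -E Re_sum; apply: eq_bigr => j _; by rewrite Re_realM.
set c := (1 - r) / (1 + r); set t := 2 / (1 - r) * r ^+ D.
suff kern y : normc y = r -> c - t <= complex.Re (2 * dirichlet D y - 1).
  have : \sum_(j < M) complex.Re (evalc h (w ^+ j)) * (c - t) <=
     \sum_(j < M) complex.Re (evalc h (w ^+ j)) * complex.Re (2 * dirichlet D ((w ^+ j)^* * z) - 1).
    apply: ler_sum => j _; apply: ler_wpM2l; first exact: hp.
    apply: kern; rewrite normcM; have -> : normc (conjC (w ^+ j)) = normc (w ^+ j) := normc_conj _.
    by rewrite w1 mul1r.
  rewrite -mulr_suml (mean_Re_evalc pw) ?h0; last by rewrite leq_addr.
  by rewrite mulr1; lra.
move=> yr.
have r1 : 0 < 1 - r by rewrite subr_gt0.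
have r2 : 0 < 1 + r by rewrite ltr_wpDr.
have y1 : 1 - y != 0.
  apply/eqP => /(congr1 (fun x => normc x)); rewrite normc0 => y0.
  have := normcD (1 - y) y; rewrite subrK normc1 y0 yr add0r; lra.
have n1 : 0 < normc (1 - y).
  rewrite lt_def normc_ge0 andbT; apply: contra y1 => /eqP/eq0_normc ->//.
have nlow : 1 - r <= normc (1 - y).
  by have := normcD (1 - y) y; rewrite subrK normc1 yr; lra.
have nup : normc (1 - y) <= 1 + r by apply: le_trans (normcB _ _) _; rewrite normc1 yr.
have -> : 2 * dirichlet D y - 1 = (1 + y) * (1 - y^*) * ((normc (1 - y) ^- 2)%:C)
   - 2 * y ^+ D / (1 - y).
  have -> : dirichlet D y = (1 - y ^+ D) / (1 - y) by rewrite -dirichlet_geo mulrC mulKf.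
  rewrite fmorphV /= sqr_normcE rmorphB rmorph1.
  have y1c : 1 - y^* != 0.
    by rewrite -(rmorph1 (@Num.conj R[i])) -rmorphB fmorph_eq0.
  by field; rewrite y1 y1c.
have -> (a b : R[i]) : complex.Re (a - b) = complex.Re a - complex.Re b by case: a b => [? ?] [? ?].
apply: lerB.
  rewrite mulrC Re_realM.
  have -> : complex.Re ((1 + y) * (1 - conjC y)) = 1 - r ^+ 2.
    have -> : (1 + y) * (1 - conjC y) = 1 - y * conjC y + (y - conjC y) by ring.
    rewrite -sqr_normcE yr; case: (y) => a b /=; rewrite subrr addr0 //.
  rewrite /c ler_pdivrMr// -mulrA ler_pdivlMl ?exprn_gt0//.
  have -> : (1 - r ^+ 2) * (1 + r) = (1 + r) ^+ 2 * (1 - r) by ring.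
  apply: ler_wpM2r; first exact: ltW.
  by rewrite lerXn2r ?nnegrE ?normc_ge0 ?(ltW r2).
apply: le_trans (ler_norm _) _; apply: le_trans (Re_normc _) _.
rewrite !normcM normcV normcX yr normc_nat /t mulrAC.
rewrite ler_wpM2r ?exprn_ge0// ler_wpM2l// lef_pV2 ?posrE//.
Qed.

(** * The coefficients of exp(-h) *)

(** Since [h] has constant coefficient 1, [exp(-h)] is written as [exp(-1) exp(1 - h)], where
    [1 - h] has no constant coefficient. *)
Definition inner_poly (R : realType) (K : nat) (h : {poly R}) : {poly R} :=
  expR (-1) *: texp K (1 - h).

Definition bcoef (R : realType) (h : {poly R}) (n : nat) : R := (inner_poly n h)`_n.

Lemma vanish_1B (R : nzRingType) (h : {poly R}) : h`_0 = 1 -> vanish 1 (1 - h).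
Proof. by move=> h0 [|//] _; rewrite coefB coef1 h0 subrr. Qed.

Lemma bcoefE (R : realType) (h : {poly R}) n K : h`_0 = 1 -> (n <= K)%N ->
  (inner_poly K h)`_n = bcoef h n.
Proof.
move=> h0 nK; rewrite /bcoef /inner_poly !coefZ; congr (_ * _).
by apply: texp_coef_stable nK => //; exact: vanish_1B.
Qed.

Lemma bcoef_congr (R : realType) (h h' : {poly R}) L n : vanish L (h' - h) -> (n < L)%N ->
  bcoef h' n = bcoef h n.
Proof.
move=> v nL; rewrite /bcoef /inner_poly !coefZ; congr (_ * _).
apply: (texp_coef_congr (L := L)) => // i iL.
have -> : 1 - h' - (1 - h) = - (h' - h) by ring.
by rewrite coefN v ?oppr0.
Qed.

Lemma expRN1_le1 (R : realType) : expR (-1 : R) <= 1.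
Proof. by rewrite -[leRHS]expR0 ler_expR lerN10. Qed.

Lemma inner_poly_sqr (R : realType) (h : {poly R}) K z : normc z <= 1 ->
  `|normc (evalc (inner_poly K h) z) ^+ 2 - expR (- (2 * complex.Re (evalc h z)))| <=
  texp_err K (l1 (1 - h)).
Proof.
move=> z1; have hl := @texp_sqr_norm R K (evalc (1 - h) z) _ (normc_evalc (1 - h) z1).
rewrite /inner_poly evalcZ evalc_texp normcM normcR [`|expR _|]ger0_norm ?expR_ge0// exprMn.
have -> : - (2 * complex.Re (evalc h z)) = (- 1) + (-1) + 2 * complex.Re (evalc (1 - h) z).
  rewrite evalcD evalc1 evalcN; case: (evalc h z) => a c /=; ring.
rewrite expRD [expR (-1 + -1)]expRD -expr2 -mulrBr normrM.
apply: le_trans hl; rewrite -[leRHS]mul1r ler_wpM2r//.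
by rewrite ger0_norm ?sqr_ge0// exprn_ile1 ?expR_ge0 ?expRN1_le1.
Qed.

(** By Parseval the sum is a mean of [exp(-2 Re h) <= 1], up to the truncation error. *)
Lemma inner_poly_sum_le (R : realType) (h : {poly R}) K D : re_pos h ->
  \sum_(i < D) ((inner_poly K h)`_i) ^+ 2 <= 1 + texp_err K (l1 (1 - h)).
Proof.
move=> hp; set P := inner_poly K h.
pose M := (maxn D (size P)).+1.
have [w pw] := prim_root_exists R (ltn0Sn (maxn D (size P))).
have w1 j : normc (w ^+ j) = 1 by rewrite normcX (prim_root_normc pw) expr1n.
have PM : (size P <= M)%N by rewrite /M leqW// leq_maxr.
have DM : (D <= M)%N by rewrite /M leqW// leq_maxl.
apply: (@le_trans _ _ (\sum_(i < M) (P`_i) ^+ 2)).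
  rewrite (big_ord_widen M (fun i => P`_i ^+ 2))// big_mkcond; apply: ler_sum => i _.
  by case: ifP => // _; exact: sqr_ge0.
have M0 : 0 < M%:R :> R by rewrite ltr0n.
rewrite -(ler_pM2l M0) -(parseval pw PM).
apply: (@le_trans _ _ (\sum_(j < M) (1 + texp_err K (l1 (1 - h))))); last first.
  by rewrite sumr_const card_ord mulr_natl.
apply: ler_sum => j _.
have := inner_poly_sqr h K (_ : normc (w ^+ j) <= 1); rewrite w1 => /(_ (lexx 1)).
rewrite ler_norml => /andP[_ h2].
have : expR (- (2 * complex.Re (evalc h (w ^+ j)))) <= 1.
  by rewrite -expR0 ler_expR oppr_le0 mulr_ge0// hp.
rewrite -/P in h2 *; lra.
Qed.

(** Parseval again: the sum is the mean of [exp(-2 Re h)], up to the truncation error. *)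
Lemma inner_poly_sum_ge (R : realType) (h : {poly R}) K M0 (delta : R) :
  (forall M w, (M0 <= M)%N -> M.-primitive_root w ->
    \sum_(j < M) (1 - expR (- (2 * complex.Re (evalc h (w ^+ j))))) <= M%:R * delta) ->
  1 - delta - texp_err K (l1 (1 - h)) <=
  \sum_(i < size (inner_poly K h)) ((inner_poly K h)`_i) ^+ 2.
Proof.
move=> hd; set P := inner_poly K h.
pose M := (maxn M0 (size P)).+1.
have [w pw] := prim_root_exists R (ltn0Sn (maxn M0 (size P))).
have w1 j : normc (w ^+ j) = 1 by rewrite normcX (prim_root_normc pw) expr1n.
have PM : (size P <= M)%N by rewrite /M leqW// leq_maxr.
have M0M : (M0 <= M)%N by rewrite /M leqW// leq_maxl.
have -> : \sum_(i < size P) (P`_i) ^+ 2 = \sum_(i < M) (P`_i) ^+ 2.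
  rewrite (big_ord_widen M (fun i => P`_i ^+ 2))// big_mkcond; apply: eq_bigr => i _.
  by case: ltnP => // iP; rewrite nth_default// expr0n.
have M0' : 0 < M%:R :> R by rewrite ltr0n.
rewrite -(ler_pM2l M0') -(parseval pw PM).
have hM := hd M w M0M pw.
apply: (@le_trans _ _ (\sum_(j < M) (1 - texp_err K (l1 (1 - h))
    - (1 - expR (- (2 * complex.Re (evalc h (w ^+ j)))))))).
  by rewrite sumrB sumr_const card_ord -[_ *+ _]mulr_natl; lra.
apply: ler_sum => j _.
have := inner_poly_sqr h K (_ : normc (w ^+ j) <= 1); rewrite w1 => /(_ (lexx 1)).
by rewrite ler_norml -/P => /andP[h2 _]; lra.
Qed.

Lemma bcoef_sum_le1 (R : realType) (h : {poly R}) D : h`_0 = 1 -> re_pos h ->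
  \sum_(i < D) bcoef h i ^+ 2 <= 1.
Proof.
move=> h0 hp; apply: (@le_null _ _ _ (fun K => texp_err (K + D) (l1 (1 - h)))).
  rewrite (cvg_shiftn D (fun K => texp_err K (l1 (1 - h)))); exact: texp_err_cvg.
move=> K; apply: le_trans (inner_poly_sum_le (K + D) D hp); apply: ler_sum => i _.
by rewrite (bcoefE h0)// (leq_trans (ltnW (ltn_ord i)))// leq_addl.
Qed.

(** [inner_poly K h] agrees with [exp(-h)] up to the degree [K] only. Its coefficients beyond
    [K] come from powers of [1 - h] of exponent larger than [K0], and are bounded by the tail
    of the exponential series. *)
Lemma bcoef_sum_ge (R : realType) (h : {poly R}) M0 (delta eps : R) :
  h`_0 = 1 -> 0 < eps ->
  (forall M w, (M0 <= M)%N -> M.-primitive_root w ->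
    \sum_(j < M) (1 - expR (- (2 * complex.Re (evalc h (w ^+ j))))) <= M%:R * delta) ->
  exists D, 1 - delta - eps <= \sum_(i < D) bcoef h i ^+ 2.
Proof.
move=> h0 eps0 hd; set g := 1 - h; set rho := l1 g.
(* The tail enters squared, and [eta^2 <= eta] for [eta <= 1]. *)
pose eta := Num.min 1 (eps / 2).
have eta0 : 0 < eta by rewrite lt_min ltr01 divr_gt0.
have [N1 hN1] := null_ex (texp_tail_cvg rho) eta0.
have eps20 : 0 < eps / 2 by rewrite divr_gt0.
have [N2 hN2] := null_ex (texp_err_cvg rho) eps20.
pose K0 := maxn N1 N2; pose K := (K0 * (size g).+1)%N.
have K0K : (K0 <= K)%N by rewrite /K leq_pmulr.
exists K.+1; set P := inner_poly K h.
have := inner_poly_sum_ge K hd; rewrite -/P -/g -/rho.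
have t1 : texp_tail K0 rho <= eta by apply: hN1; rewrite leq_maxl.
have t2 : texp_err K rho <= eps / 2.
  by apply: hN2; apply: leq_trans K0K; rewrite leq_maxr.
have -> : \sum_(i < K.+1) bcoef h i ^+ 2 = \sum_(i < K.+1) P`_i ^+ 2.
  by apply: eq_bigr => i _; rewrite (bcoefE h0)// -ltnS.
have split := @sum_ord_split R (fun i => P`_i ^+ 2) K.+1 (size P) (fun i => sqr_ge0 _).
suff tail : \sum_(K.+1 <= i < size P) P`_i ^+ 2 <= eps / 2 by lra.
have tl0 : 0 <= texp_tail K0 rho.
  by apply: le_trans (l1_ge0 _) (l1_texp_tail g K0K).
apply: (@le_trans _ _ (texp_tail K0 rho ^+ 2)); last first.
  have : eta <= 1 by rewrite ge_min lexx.
  have : eta <= eps / 2 by rewrite ge_min lexx orbT.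
  by nra.
pose Q := texp K g - texp K0 g.
apply: (@le_trans _ _ ((\sum_(i < size P) `|Q`_i|) ^+ 2)); last first.
  rewrite lerXn2r ?nnegrE ?sumr_ge0//.
  apply: le_trans (l1_partial _ _) _; exact: l1_texp_tail.
apply: le_trans (@sum_sqr_le R (size P) (fun i => `|Q`_i|) (fun i => normr_ge0 _)).
have [PK|KP] := leqP (size P) K.+1.
  by rewrite big_geq// sumr_ge0// => i _; exact: sqr_ge0.
rewrite -(big_mkord xpredT (fun i => `|Q`_i| ^+ 2)) (@big_cat_nat _ _ _ K.+1 0 (size P)) ?(ltnW KP)//=.
apply: ler_wpDl; first by rewrite sumr_ge0// => i _; exact: sqr_ge0.
rewrite !big_nat; apply: ler_sum => i /andP[Ki _].
have -> : P`_i = expR (-1) * Q`_i.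
  rewrite /P /inner_poly coefZ /Q coefB [(texp K0 g)`_i]nth_default ?subr0//.
  apply: leq_trans (size_texp _ _) _; apply: leq_trans Ki.
  by rewrite ltnS /K leq_mul2l leqnSn orbT.
rewrite real_normK ?num_real// exprMn -[leRHS]mul1r; apply: ler_wpM2r; first exact: sqr_ge0.
by rewrite exprn_ile1 ?expR_ge0 ?expRN1_le1.
Qed.

(** The partial sum differs from [exp(-h(z))] by a tail of the power series, and
    [Re h(z) >= (1 - r)/(1 + r)]. *)
Lemma bcoef_disc (R : realType) (h : {poly R}) L z :
  h`_0 = 1 -> re_pos h -> normc z < 1 ->
  normc (\sum_(i < L) (bcoef h i)%:C * z ^+ i) <=
  expR (- ((1 - normc z) / (1 + normc z))) + 2 / (1 - normc z) * normc z ^+ L.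
Proof.
move=> h0 hp z1; have z0 := normc_ge0 z; set r := normc z.
have r1 : 0 < 1 - r by rewrite subr_gt0.
set c := (1 - r) / (1 + r).
have hz := herglotz_bound h0 hp z1.
have [N hN] := null_ex (texp_err_cvg (l1 (1 - h))) ltr01.
set s := \sum_(i < L) _.
have main K : (N <= K)%N -> (L <= K)%N ->
   normc s <= normc (evalc (inner_poly K h) z) + 2 / (1 - r) * r ^+ L.
  move=> NK LK; set P := inner_poly K h.
  have Pi i : `|P`_i| <= 2.
    rewrite -(@ler_pXn2r _ 2) ?nnegrE// real_normK ?num_real//.
    have := inner_poly_sum_le K i.+1 hp; rewrite big_ord_recr /= -/P => h1.
    have h2 : 0 <= \sum_(i0 < i) P`_i0 ^+ 2 by rewrite sumr_ge0// => j _; exact: sqr_ge0.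
    by have := hN _ NK; lra.
  have -> : s = evalc P z - \sum_(L <= i < maxn L (size P)) (P`_i)%:C * z ^+ i.
    rewrite (evalcE z (leq_maxr L (size P))).
    rewrite -(big_mkord xpredT (fun i => (P`_i)%:C * z ^+ i)).
    rewrite (@big_cat_nat _ _ _ L 0)//= ?leq_maxl// addrK big_mkord.
    apply: eq_bigr => i _; rewrite (bcoefE h0)//.
    by rewrite (leq_trans (ltnW (ltn_ord i))).
  apply: le_trans (normcB _ _) _; rewrite lerD2l; apply: le_trans (normc_sum _ _ _) _.
  apply: (@le_trans _ _ (\sum_(L <= i < maxn L (size P)) 2 * r ^+ i)).
    by apply: ler_sum => i _; rewrite normcM normcR normcX ler_wpM2r ?exprn_ge0.
  rewrite -mulr_sumr -mulrA ler_wpM2l// mulrC; apply: sum_geo_le.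
  by rewrite z0.
rewrite -lerBlDr; set t := normc s - _.
have [t0|t0] := lerP t 0; first by apply: le_trans t0 (expR_ge0 _).
rewrite -(@ler_pXn2r _ 2) ?nnegrE ?expR_ge0 ?(ltW t0)//.
apply: (@le_null _ _ _ (fun K => texp_err (K + (N + L))%N (l1 (1 - h)))).
  rewrite (cvg_shiftn (N + L) (fun K => texp_err K (l1 (1 - h)))); exact: texp_err_cvg.
move=> K'; set K := (K' + _)%N.
have tP : t <= normc (evalc (inner_poly K h) z).
  by rewrite /t lerBlDr; apply: main; rewrite /K; lia.
apply: (@le_trans _ _ (normc (evalc (inner_poly K h) z) ^+ 2)).
  by rewrite lerXn2r ?nnegrE ?normc_ge0 ?(ltW t0).
have := inner_poly_sqr h K (ltW z1); rewrite ler_norml => /andP[_ h2].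
have : expR (- (2 * complex.Re (evalc h z))) <= expR (- c) ^+ 2.
  rewrite expr2 -expRD ler_expR; move: hz; rewrite -/r -/c; lra.
lra.
Qed.

(** * The construction *)

(** Shifting to the right does not increase a weighted sum with decreasing weights. *)
Lemma conv_weighted (R : realType) (p : {poly R}) (b w : nat -> R) (W : R) N :
  (forall n, 0 <= w n) -> (forall n, w n.+1 <= w n) ->
  (forall N, \sum_(n < N) `|b n| * w n <= W) ->
  \sum_(n < N) `|conv p b n| * w n <= l1 p * W.
Proof.
move=> w0 wd hW.
have W0 : 0 <= W by have := hW 0%N; rewrite big_ord0.
have wmono k i : w (i + k)%N <= w i.
  by elim: k => [|k IH]; rewrite ?addn0// addnS; apply: le_trans (wd _) IH.
apply: (@le_trans _ _ (\sum_(n < N) \sum_(j < n.+1) `|p`_j| * (`|b (n - j)%N| * w (n - j)%N))).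
  apply: ler_sum => n _; apply: le_trans (ler_wpM2r (w0 _) (ler_norm_sum _ _ _)) _.
  rewrite mulr_suml; apply: ler_sum => j _.
  rewrite normrM -mulrA ler_wpM2l// ler_wpM2l//.
  have jn : (j <= n)%N by rewrite -ltnS.
  by rewrite -{1}(subnK jn).
rewrite (triangle_sum (fun j i => `|p`_j| * (`|b i| * w i))).
apply: (@le_trans _ _ (\sum_(j < N) `|p`_j| * W)).
  by apply: ler_sum => j _; rewrite -mulr_sumr ler_wpM2l.
by rewrite -mulr_suml ler_wpM2r// l1_partial.
Qed.

(** A stage [h_J] of the construction: [gap] is the order up to which it agrees with the
    previous stage, and [cutoff] a number of coefficients of [exp(-h_J)] which carry most of
    its square norm; the next gap is taken beyond it. *)
Record stage (R : realType) := Stage {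
  exponent : {poly R};
  l1_bound : R;
  gap : nat;
  cutoff : nat
}.

Record stage_ok (R : realType) (s : stage R) : Prop := StageOk {
  stage_h0 : s.(exponent)`_0 = 1;
  stage_pos : re_pos s.(exponent);
  stage_l1 : l1 s.(exponent) <= s.(l1_bound)
}.

Record stage_rel (R : realType) (w : nat -> R) (n : nat)
    (s t : stage R) : Prop := StageRel {
  stage_C : s.(l1_bound) <= t.(l1_bound);
  stage_L : (s.(gap) <= t.(gap))%N;
  stage_Ln : (n < t.(gap))%N;
  stage_LD : (s.(cutoff) <= t.(gap))%N;
  stage_low : vanish t.(gap) (t.(exponent) - s.(exponent));
  stage_w : w t.(gap) * expR (2 * t.(l1_bound)) <= 2^-1 ^+ n;
  stage_norm : 1 - 13 / n.+1%:R <= \sum_(i < t.(cutoff)) bcoef t.(exponent) i ^+ 2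
}.

(** The bound [C'] of the l1 norm depends on [h] and [n] only, so the gap [L'] can be chosen
    after it, beyond a rank where [w] is small compared to [exp(-2 C')]. *)
Lemma stage_next (R : realType) (w : nat -> R) (n : nat) s :
  w n @[n --> \oo] --> (0 : R) -> stage_ok s ->
  exists2 t, stage_ok t & stage_rel w n s t.
Proof.
case: s => [h C L D] w0 [/= h0 hp hC].
have C0 : 0 <= C := le_trans (l1_ge0 _) hC.
(* The order of the Fejer kernel required by [mean_one_minus_exp]. *)
pose m := (n.+1 ^ 3)%N; pose C' := C * (1 + 2 * m%:R).
have CC' : C <= C' by rewrite /C' ler_peMr// lerDl mulr_ge0.
have bound0 : 0 < 2^-1 ^+ n * expR (- (2 * C')) by rewrite mulr_gt0 ?expR_gt0 ?exprn_gt0.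
have [N hN] := null_ex w0 bound0.
pose L' := (L + n.+1 + D + N)%N.
have L'0 : (0 < L')%N by rewrite /L'; lia.
set h' := lac_step h L' m.
have low : vanish L' (h' - h) by exact: lac_step_low.
have h'0 : h'`_0 = 1 by have := low 0%N L'0; rewrite coefB h0 => /eqP; rewrite subr_eq0 => /eqP.
have h'p : re_pos h'.
  move=> z z1; rewrite Re_lac_step ?expn_gt0//; apply: mulr_ge0; first exact: hp.
  by rewrite divr_ge0 ?sqr_ge0.
have h'C : l1 h' <= C'.
  apply: le_trans (l1_lac_step _ _ _) _; apply: ler_wpM2r hC.
  by rewrite addr_ge0 ?mulr_ge0.
have n0 : 0 < n.+1%:R :> R by rewrite ltr0n.
have n10 : 0 < n.+1%:R^-1 :> R by rewrite invr_gt0.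
have [D' hD'] := @bcoef_sum_ge R h' (size h + n.+1 * (L' + size h))%N (12 / n.+1%:R) n.+1%:R^-1 h'0 n10
  (fun M v hM pv => mean_one_minus_exp h0 hp (ltn0Sn n) L'0 pv
     (leq_trans (leq_addr _ _) hM) (leq_trans (leq_addl _ _) hM)).
exists (Stage h' C' L' D'); split => //=.
- by rewrite /L'; lia.
- by rewrite /L'; lia.
- by rewrite /L'; lia.
- apply: (@le_trans _ _ (2^-1 ^+ n * expR (- (2 * C')) * expR (2 * C'))).
    by rewrite ler_wpM2r ?expR_ge0//; apply: hN; rewrite /L'; lia.
  by rewrite -mulrA -expRD addNr expR0 mulr1.
- apply: le_trans hD'; move: (n.+1%:R^-1) => x.
  by have -> : 1 - 13 * x = 1 - 12 * x - x by ring.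
Qed.

Lemma stage_sequence (R : realType) (w : nat -> R) :
  w n @[n --> \oo] --> (0 : R) ->
  exists s : nat -> stage R,
    [/\ (s 0%N).(exponent) = 1, forall n, stage_ok (s n) & forall n, stage_rel w n (s n) (s n.+1)].
Proof.
move=> w0.
have /choice[F hF] : forall x : nat * (stage R), exists t,
    stage_ok x.2 -> stage_ok t /\ stage_rel w x.1 x.2 t.
  move=> [n s]; have [ok|] := pselect (stage_ok s); last by exists s.
  by have [t okt rt] := stage_next n w0 ok; exists t.
pose s := fix s n := if n is m.+1 then F (m, s m) else Stage (1 : {poly R}) 1 0 0.
have ok n : stage_ok (s n).
  elim: n => [|n IH]; last by have [] := hF (n, s n) IH.
  split => /=; rewrite ?coef1 ?l1_1// => z _.
  by rewrite evalc1.
exists s; split => // n.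
by have [] := hF (n, s n) (ok n).
Qed.

Section Construction.
Variables (R : realType) (w : nat -> R).
Hypothesis w_gt0 : forall n, 0 < w n.
Hypothesis w_decr : forall n, w n.+1 <= w n.
Variable s : nat -> stage R.
Hypothesis s_init : (s 0%N).(exponent) = 1.
Hypothesis s_ok : forall n, stage_ok (s n).
Hypothesis s_rel : forall n, stage_rel w n (s n) (s n.+1).

Let h n := (s n).(exponent).
Let C n := (s n).(l1_bound).
Let L n := (s n).(gap).
Let D n := (s n).(cutoff).

(** The stage [n] has reached its final coefficients up to the order [n], because the next gap
    lies beyond [n]. *)
Definition limit_coef n := bcoef (h n) n.
Local Notation b := limit_coef.

Lemma gap_mono i j : (i <= j)%N -> (L i <= L j)%N.
Proof.
by move=> ij; rewrite -(subnK ij); elim: (j - i)%N => // k IH; rewrite addSn; apply: leq_trans IH (stage_L (s_rel _)).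
Qed.

Lemma l1_bound_mono i j : (i <= j)%N -> C i <= C j.
Proof.
by move=> ij; rewrite -(subnK ij); elim: (j - i)%N => // k IH; rewrite addSn; apply: le_trans IH (stage_C (s_rel _)).
Qed.

Lemma exponent_stable i j : (i <= j)%N -> vanish (L i.+1) (h j - h i).
Proof.
move=> ij; rewrite -(subnK ij); elim: (j - i)%N => [|k IH] n nL; first by rewrite subrr coef0.
have -> : h (k.+1 + i)%N - h i = (h (k + i).+1 - h (k + i)%N) + (h (k + i)%N - h i).
  by rewrite addSn; ring.
rewrite coefD IH// addr0; apply: (stage_low (s_rel (k + i)%N)).
by apply: leq_trans nL _; apply: gap_mono; rewrite ltnS leq_addl.
Qed.

Lemma limit_coefE n j : (n < L j.+1)%N -> b n = bcoef (h j) n.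
Proof.
move=> nL; have [jn|/ltnW nj] := leqP j n.
  exact: bcoef_congr (exponent_stable jn) nL.
apply/esym; apply: bcoef_congr (exponent_stable nj) _; exact: stage_Ln (s_rel n).
Qed.

Lemma limit_norm_le1 N : \sum_(n < N) b n ^+ 2 <= 1.
Proof.
have -> : \sum_(n < N) b n ^+ 2 = \sum_(n < N) bcoef (h N) n ^+ 2.
  apply: eq_bigr => n _; rewrite (@limit_coefE n N)//.
  by apply: ltn_trans (ltn_ord n) (stage_Ln (s_rel N)).
by apply: bcoef_sum_le1; [exact: stage_h0 (s_ok N) | exact: stage_pos (s_ok N)].
Qed.

Lemma limit_coef_le1 n : `|b n| <= 1.
Proof.
rewrite -(@ler_pXn2r _ 2) ?nnegrE// real_normK ?num_real// expr1n.
apply: le_trans (limit_norm_le1 n.+1); rewrite big_ord_recr /= lerDr.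
by rewrite sumr_ge0// => i _; exact: sqr_ge0.
Qed.

(** The cutoff of each stage lies below the next gap, so the final coefficients carry the
    square norm achieved at every stage. *)
Lemma limit_norm : \sum_(n < N) b n ^+ 2 @[N --> \oo] --> (1 : R).
Proof.
apply/cvgrPdist_le => eps eps0.
have hgeo : 13 / n.+1%:R @[n --> \oo] --> (0 : R).
  by rewrite -(mulr0 13); apply: cvgMr; exact: cvg_harmonic.
have [J hJ] := null_ex hgeo eps0.
near=> N; have DN : (D J.+1 <= N)%N by near: N; exact: nbhs_infty_ge.
rewrite ger0_norm ?subr_ge0 ?limit_norm_le1//.
have h1 : \sum_(n < D J.+1) bcoef (h J.+1) n ^+ 2 <= \sum_(n < N) b n ^+ 2.
  rewrite (eq_bigr (fun n : 'I_(D J.+1) => b n ^+ 2)) => [|n _]; last first.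
    rewrite (@limit_coefE n J.+1)//.
    by apply: leq_trans (ltn_ord n) (stage_LD (s_rel J.+1)).
  rewrite (big_ord_widen N (fun i => b i ^+ 2))// big_mkcond; apply: ler_sum => i _.
  by case: ifP => // _; exact: sqr_ge0.
have h2 : 1 - 13 / J.+1%:R <= \sum_(n < D J.+1) bcoef (h J.+1) n ^+ 2.
  exact: stage_norm (s_rel J).
move: (le_trans h2 h1) (hJ J (leqnn J)).
by set S := \sum_(n < N) _; set q := 13 / _ => h3 h4; lra.
Unshelve. all: by end_near. Qed.

Lemma limit_disc z v : normc z < 1 -> sums_to (fun n => (b n)%:C) z v -> normc v < 1.
Proof.
move=> z1 /sums_toP[e e0 he]; have z0 := normc_ge0 z.
have r1 : 0 < 1 - normc z by rewrite subr_gt0.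
apply: (@le_lt_trans _ _ (expR (- ((1 - normc z) / (1 + normc z))))); last first.
  by rewrite -[ltRHS]expR0 ltr_expR oppr_lt0 divr_gt0// ltr_wpDr.
apply: (@le_null _ _ _ (fun J => e J + 2 / (1 - normc z) * normc z ^+ J)).
  by apply: null_add => //; apply: null_geo; rewrite z0.
move=> J; have := bcoef_disc J (stage_h0 (s_ok J)) (stage_pos (s_ok J)) z1.
rewrite -/(h J).
have -> : \sum_(i < J) (bcoef (h J) i)%:C * z ^+ i = \sum_(i < J) (b i)%:C * z ^+ i.
  apply: eq_bigr => i _; rewrite (@limit_coefE i J)//.
  by apply: ltn_trans (ltn_ord i) (stage_Ln (s_rel J)).
move=> h1; have h2 := he J.
have := normcD (v - \sum_(k < J) (b k)%:C * z ^+ k) (\sum_(k < J) (b k)%:C * z ^+ k).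
rewrite subrK; lra.
Qed.

Lemma vanish1_diff i j : vanish 1 (h i - h j).
Proof.
by case=> // _; rewrite coefB (stage_h0 (s_ok i)) (stage_h0 (s_ok j)) subrr.
Qed.

(** Going from the stage [I] to the stage [I + 1] changes the coefficients of [exp(h_K - h_I)]
    only beyond the gap [L (I + 1)]. There the weights are at most [w (L (I + 1))], and the l1
    norm of the new exponential is at most [exp (2 C (I + 1))]. *)
Lemma ratio_weighted K J : (K <= J)%N ->
  \sum_(1 <= n < L J.+1) `|(texp n (h K - h J))`_n| * w n <= \sum_(K <= j < J) 2^-1 ^+ j.
Proof.
move=> KJ; rewrite -(subnK KJ); elim: (J - K)%N => [|k IH].
  rewrite [leRHS]big_geq// big_nat big1// => n /andP[n0 _].
  rewrite subrr texp_poly coef_sum big1 ?normr0 ?mul0r// => i _.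
  rewrite coefZ expr0n; case: (i : nat) => [|i']; rewrite ?coef0 ?mulr0//.
  by rewrite coef1 -[_ == _]/(n == 0)%N (gtn_eqF n0) mulr0.
set I := (k + K)%N in IH *; rewrite addSn -/I.
have LL : (L I.+1 <= L I.+2)%N by exact: gap_mono.
have L1 : (1 <= L I.+1)%N by apply: leq_trans (stage_Ln (s_rel I)).
rewrite (@big_cat_nat _ _ _ (L I.+1) 1 (L I.+2))//= (@big_cat_nat _ _ _ I K I.+1) ?leq_addl//=.
rewrite big_nat1; apply: lerD.
  rewrite big_nat; apply: le_trans IH; rewrite [leRHS]big_nat; apply: ler_sum => n /andP[_ nL].
  rewrite (texp_coef_congr (L := L I.+1) (q := h K - h I))// => i iL.
  have -> : h K - h I.+1 - (h K - h I) = - (h I.+1 - h I) by ring.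
  by rewrite coefN (stage_low (s_rel I)) ?oppr0.
apply: le_trans (stage_w (s_rel I)); rewrite -/(L I.+1) -/(C I.+1).
pose N := L I.+2; pose q := h K - h I.+1.
apply: (@le_trans _ _ (\sum_(L I.+1 <= n < N) w (L I.+1) * `|(texp N q)`_n|)).
  rewrite big_nat [leRHS]big_nat; apply: ler_sum => n /andP[Ln nN].
  rewrite mulrC (@texp_coef_stable _ q n n N (vanish1_diff _ _))//; last exact: ltnW.
  rewrite ler_wpM2r//.
  have wmono i : w (i + L I.+1)%N <= w (L I.+1).
    by elim: i => // i IHi; rewrite addSn; apply: le_trans (w_decr _) IHi.
  by rewrite -(subnK Ln).
rewrite -mulr_sumr ler_wpM2l ?(ltW (w_gt0 _))//.
apply: (@le_trans _ _ (l1 (texp N q))).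
  apply: le_trans (l1_partial (texp N q) N).
  rewrite -(big_mkord xpredT (fun i => `|(texp N q)`_i|)) (@big_cat_nat _ _ _ (L I.+1) 0 N)//=.
  by rewrite lerDr sumr_ge0.
apply: le_trans (l1_texp _ _) _; rewrite ler_expR.
apply: le_trans (l1D _ _) _; rewrite l1N mulr2n mulrDl mul1r; apply: lerD.
  apply: le_trans (stage_l1 (s_ok K)) _; apply: l1_bound_mono; exact: leqW (leq_addl _ _).
exact: stage_l1 (s_ok I.+1).
Qed.

Lemma ratio_weighted_le K N :
  \sum_(1 <= n < N) `|(texp n (h K - h (K + N)%N))`_n| * w n <= 2 * 2^-1 ^+ K.
Proof.
apply: (@le_trans _ _ (\sum_(1 <= n < L (K + N).+1) `|(texp n (h K - h (K + N)%N))`_n| * w n)).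
  have NL : (N <= L (K + N).+1)%N.
    by apply: leq_trans (ltnW (stage_Ln (s_rel _))); rewrite leq_addl.
  have [N0|N1] := leqP N 1.
    by rewrite big_geq// sumr_ge0// => n _; rewrite mulr_ge0// ltW.
  rewrite (@big_cat_nat _ _ _ N 1 (L (K + N).+1)) ?(ltnW N1)//= lerDl sumr_ge0// => n _.
  by rewrite mulr_ge0// ltW.
apply: le_trans (ratio_weighted (leq_addr N K)) _.
apply: le_trans (sum_geo_le _ _ _) _; first by lra.
by rewrite (_ : 2^-1 ^+ K / (1 - 2^-1) = 2 * 2^-1 ^+ K :> R)//; field.
Qed.

(** This is [ratio_weighted_le] with [K = 0], since [h 0 = 1]. *)
Lemma limit_weighted N : \sum_(n < N) `|b n| * w n <= w 0%N + 2.
Proof.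
case: N => [|N]; first by rewrite big_ord0 addr_ge0 ?ltW.
rewrite big_ord_recl; apply: lerD.
  by rewrite -[leRHS]mul1r ler_wpM2r ?limit_coef_le1// ltW.
apply: le_trans (le_trans (ratio_weighted_le 0 N.+1) _); last by rewrite expr0 mulr1.
rewrite big_add1 /= big_mkord; apply: ler_sum => i _.
rewrite ler_wpM2r ?(ltW (w_gt0 _))//.
rewrite (@limit_coefE _ (0 + N.+1)); last first.
  by apply: leq_trans (stage_Ln (s_rel _)); rewrite /bump /= !add1n add0n !ltnS ltnW.
rewrite /bcoef /inner_poly coefZ normrM ger0_norm ?expR_ge0//.
have -> : h 0%N = 1 by exact: s_init.
rewrite -[leRHS]mul1r.
by apply: ler_wpM2r => //; exact: expRN1_le1.
Qed.

(** The multiplier is a truncation of [exp(h_K)]. Up to the error of the truncation, its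
    product with [exp(-h_J)] is [exp(h_K - h_J)]. *)
Lemma limit_cyclic eps : 0 < eps -> exists p : {poly R}, conv p b 0 = 1 /\
   forall N, \sum_(1 <= n < N) `|conv p b n| * w n <= eps.
Proof.
move=> eps0; have eps20 : 0 < eps / 2 by rewrite divr_gt0.
have half01 : 0 <= (2^-1 : R) < 1 by lra.
have [K hK] := null_ex (null_geo 2 half01) eps20.
have {}hK := hK K (leqnn K).
pose g := h K - 1.
have vg : vanish 1 g.
  by case=> // _; rewrite coefB coef1 (stage_h0 (s_ok K)) subrr.
pose W := w 0%N + 2; have W0 : 0 < W by rewrite ltr_wpDr.
have e0 : 0 < eps / 2 / (expR 1 * W) by rewrite divr_gt0// mulr_gt0 ?expR_gt0.
have [T hT] := null_ex (texp_tail_cvg (l1 g)) e0.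
have {}hT := hT T (leqnn T).
pose p K' := expR 1 *: texp K' g.
exists (p T); split.
  rewrite /conv big_ord1 /p coefZ subn0 (texp_coef_stable (K := 0) vg)//.
  rewrite /b /bcoef /inner_poly coefZ (texp_coef_stable (K := 0))//; last first.
    exact: vanish_1B (stage_h0 (s_ok 0%N)).
  rewrite !texp_poly !big_ord1 !expr0 !coefZ coef1 /= fact0 invr1 !mulr1.
  by rewrite -expRD subrr expR0.
move=> N; pose K' := maxn T N; pose J := (K + N)%N.
pose tail := p K' - p T.
have convE n : (n < N)%N -> conv (p T) b n = (texp n (h K - h J))`_n - conv tail b n.
  move=> nN; apply/eqP; rewrite -subr_eq opprK -convD /tail addrC subrK.
  have nK' : (n <= K')%N by rewrite /K' leq_max (ltnW nN) orbT.
  have -> : conv (p K') b n = (p K' * inner_poly K' (h J))`_n.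
    rewrite coefM; apply: eq_bigr => j _; congr (_ * _).
    rewrite (@limit_coefE _ J) ?(bcoefE (stage_h0 (s_ok J)))//.
      by rewrite (leq_trans (leq_subr _ _)).
    apply: leq_trans (ltnW (stage_Ln (s_rel J))).
    by rewrite /J; have := leq_subr j n; lia.
  rewrite /p /inner_poly -scalerAl -scalerAr scalerA -expRD subrr expR0 scale1r.
  rewrite texpM_coef//; last exact: vanish_1B (stage_h0 (s_ok J)).
  have -> : g + (1 - h J) = h K - h J by rewrite /g; ring.
  by rewrite (@texp_coef_stable _ _ n n K' (vanish1_diff _ _)).
apply: (@le_trans _ _ (\sum_(1 <= n < N) `|(texp n (h K - h J))`_n| * w n +
   \sum_(n < N) `|conv tail b n| * w n)).
  apply: (@le_trans _ _ (\sum_(1 <= n < N) (`|(texp n (h K - h J))`_n| * w n + `|conv tail b n| * w n))).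
    rewrite big_nat [leRHS]big_nat; apply: ler_sum => n /andP[_ nN].
    by rewrite convE// -mulrDl ler_wpM2r ?(ltW (w_gt0 _))// ler_normB.
  rewrite big_split /= lerD2l.
  case: (N) => [|N']; first by rewrite big_geq// big_ord0.
  rewrite big_add1 /= big_mkord big_ord_recl lerDr.
  by rewrite mulr_ge0// ltW.
rewrite (splitr eps); apply: lerD; first exact: le_trans (ratio_weighted_le K N) hK.
apply: le_trans (conv_weighted tail N (fun n => ltW (w_gt0 n)) w_decr limit_weighted) _.
rewrite -/W -ler_pdivlMr//.
rewrite /tail /p -scalerBr l1Z ger0_norm ?expR_ge0//.
rewrite mulrC -ler_pdivlMr ?expR_gt0//.
apply: le_trans (l1_texp_tail g (leq_maxl T N)) _; apply: le_trans hT _.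
by rewrite invfM mulrA mulrAC.
Qed.

End Construction.

Theorem theorem2p7 (R : realType) (w : nat -> R)
    (w_gt0 : forall n, 0 < w n)
    (w_decr : forall n, w n.+1 <= w n)
    (w_lim : w n @[n --> \oo] --> (0 : R)) :
  exists b : R[i] -> R[i],
    [/\ holomorphic_on_disc b,
        (forall z, unit_disc z -> unit_disc (b z)) &
        forall f : R[i] -> R[i], in_dBR b f ->
          (forall n, `|taylor_coef f n| <= (w n)%:C) ->
          forall z, unit_disc z -> f z = 0].
Proof.
have [s [s0 sok srel]] := stage_sequence w_lim.
apply: (@dBR_uniqueness R w (limit_coef s)) => //.
- exact: limit_coef_le1 srel.
- move=> z v; exact: limit_disc srel z v.
- exact: limit_norm srel.
- exact: limit_cyclic srel.
Qed.
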